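(* Let $q\in\mathbb{C}^\times$ be such that $q^2$ has finite multiplicative order $\ell\geq 4$. Let $t=a\ell+b$ with integers $a\geq 0$ and $0\leq b\leq\ell-2$, and set $L_t^{(\ell)}(x)=\sum_{k=0}^\infty \dim\bigl(L_t(t+2k)\bigr)x^k$, where $L_t(n)$ is the simple quotient of the cell module $W_t(n)$ of the Temperley-Lieb algebra $\mathrm{TL}_n(q)$. Then, as formal power series, $$L_t^{(\ell)}(x)=\frac{p_{\ell-1-b}(x)}{p_{\ell}(x)}\,c(x)^{a\ell},$$ where $c(x)=\sum_{n\geq 0}\frac{1}{n+1}\binom{2n}{n}x^n$ is the Catalan series and the polynomials $p_i(x)\in\mathbb{Z}[x]$ are defined by $p_1(x)=p_2(x)=1$ and $p_{i+1}(x)=p_i(x)-xp_{i-1}(x)$ for $i\geq 2$.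
   Context: For $n\geq 0$, $\mathrm{TL}_n(q)$ is the associative unital $\mathbb{C}$-algebra with generators $f_1,\dots,f_{n-1}$ and relations $f_i^2=-(q+q^{-1})f_i$, $f_if_{i\pm1}f_i=f_i$, $f_if_j=f_jf_i$ if $|i-j|\geq 2$. Equivalently, it has as basis the planar Temperley-Lieb diagrams from $n$ to $n$. Here a Temperley-Lieb diagram from $t$ to $n$ is a non-crossing pairing (up to isotopy) of $t$ bottom points and $n$ top points; diagrams are composed by stacking, with each closed loop replaced by the scalar $-(q+q^{-1})$, and $f_i$ is the diagram with one cup and one cap at positions $i,i+1$. A diagram $t\to n$ is monic if every bottom point is joined to a top point. For $0\leq t\leq n$ with $t\equiv n \pmod 2$, the cell module $W_t(n)$ has as basis the monic diagrams $t\to n$; $\mathrm{TL}_n(q)$ acts by composition, where non-monic results are set to $0$. In particular $W_0(0)$ is one-dimensional, spanned by the empty diagram. There is a bilinear form on $W_t(n)$ defined on monic diagrams $D_1,D_2$ as follows: with $D^*$ the reflection of $D$ in a horizontal line, if $D_1^*D_2$ is a scalar multiple of the identity diagram $\mathrm{id}_t$, then $D_1^*D_2=(D_1,D_2)\,\mathrm{id}_t$; otherwise $(D_1,D_2)=0$. Its radical $\mathrm{Rad}_t$ is a submodule, and $L_t(n):=W_t(n)/\mathrm{Rad}_t$. *)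

(* Defs.v *)
From HB Require Import structures.
From mathcomp Require Import all_boot all_order all_algebra.
From mathcomp Require Import boolp reals complex zify.

Set Implicit Arguments.
Unset Strict Implicit.
Unset Printing Implicit Defensive.

Import GRing.Theory.
Local Open Scope ring_scope.

Section QuotientSpace.
Variables (K : fieldType) (V : vectType K) (U : {vspace V}).
Local Open Scope quotient_scope.

Definition quotv := Quotient.quot (pred_of_vspace U).

HB.instance Definition _ := GRing.Zmodule.on quotv.

Definition quotv_pi (v : V) : quotv := \pi_quotv v.

Lemma quotv_piE v w : (quotv_pi v == quotv_pi w) = (v - w \in U).
Proof. by rewrite /quotv_pi Quotient.idealrBE. Qed.

Lemma quotv_piD v w : quotv_pi (v + w) = quotv_pi v + quotv_pi w.
Proof. by rewrite /quotv_pi raddfD. Qed.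

Lemma quotv_reprK (x : quotv) : quotv_pi (repr x) = x.
Proof. by rewrite /quotv_pi reprK. Qed.

Definition quotv_scale (k : K) (x : quotv) : quotv := quotv_pi (k *: repr x).

Lemma quotv_scaleE k v : quotv_scale k (quotv_pi v) = quotv_pi (k *: v).
Proof.
apply/eqP; rewrite quotv_piE -scalerBr memvZ //.
by rewrite -quotv_piE quotv_reprK.
Qed.

Lemma quotv_scalerA a b x :
  quotv_scale a (quotv_scale b x) = quotv_scale (a * b) x.
Proof. by rewrite -[x]quotv_reprK !quotv_scaleE scalerA. Qed.

Lemma quotv_scale1r : left_id 1 quotv_scale.
Proof. by move=> x; rewrite -[x]quotv_reprK quotv_scaleE scale1r. Qed.

Lemma quotv_scalerDr : right_distributive quotv_scale +%R.
Proof.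
move=> a x y; rewrite -[x]quotv_reprK -[y]quotv_reprK.
by rewrite -quotv_piD !quotv_scaleE scalerDr quotv_piD.
Qed.

Lemma quotv_scalerDl x : {morph quotv_scale^~ x : a b / a + b}.
Proof.
by move=> a b; rewrite -[x]quotv_reprK !quotv_scaleE scalerDl quotv_piD.
Qed.

HB.instance Definition _ := GRing.Zmodule_isLmodule.Build K quotv
  quotv_scalerA quotv_scale1r quotv_scalerDr quotv_scalerDl.

Lemma quotv_piZ k v : quotv_pi (k *: v) = k *: quotv_pi v.
Proof. by rewrite -quotv_scaleE. Qed.

Lemma quotv_vect_iso : Vector.axiom (\dim U^C) quotv.
Proof.
pose W := (U^C)%VS.
have UW0 : (U :&: W = 0)%VS by apply: capv_compl.
pose g (x : quotv) : subvs_of W := vsproj W (daddv_pi W U (repr x)).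
have UW : (W + U)%VS = fullv by rewrite addvC addv_complf.
have WU0 : (W :&: U = 0)%VS by rewrite capvC.
have gE v : vsval (g (quotv_pi v)) = daddv_pi W U v.
  rewrite /g vsprojK ?memv_pi //.
  set r := repr _; apply/eqP; rewrite -subr_eq0 -linearB /=.
  have rU : r - v \in U by rewrite -quotv_piE quotv_reprK.
  suff: daddv_pi U W (r - v) + daddv_pi W U (r - v) = r - v.
    by rewrite daddv_pi_id // => /(canRL (addKr _)) ->; rewrite addNr.
  by apply: daddv_pi_add; rewrite // addvC UW memvf.
have glin : linear g.
  move=> k x y; apply: val_inj => /=.
  rewrite -[x]quotv_reprK -[y]quotv_reprK -quotv_piZ -quotv_piD.
  by rewrite !gE linearP.
have gbij : bijective g.
  exists (fun w => quotv_pi (vsval w)) => [x | w].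
    apply/eqP; rewrite -[x in X in _ == X]quotv_reprK quotv_piE.
    rewrite -{1}[x]quotv_reprK gE; set r := repr x.
    have: daddv_pi W U r + daddv_pi U W r = r.
      by apply: daddv_pi_add; rewrite // UW memvf.
    move/(canRL (addKr _)) => E.
    by rewrite -opprB memvN addrC -E memv_pi.
  by apply: val_inj => /=; rewrite gE daddv_pi_id // subvsP.
have [f flin fbij] := subvs_vect_iso W.
exists (f \o g); last exact: bij_comp.
by move=> k x y /=; rewrite glin flin.
Qed.

HB.instance Definition _ := Lmodule_hasFinDim.Build K quotv quotv_vect_iso.

Lemma dim_quotv : (\dim {:quotv} = \dim {:V} - \dim U)%N.
Proof. by rewrite dimvf /dim /= dimv_compl dimvf. Qed.

End QuotientSpace.

Record fps (R : Type) := FPS { fps_coef :> nat -> R }.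

Section FormalPowerSeries.
Variable R : comUnitRingType.
Implicit Types f g h : fps R.

Lemma fps_ext f g : (forall n, f n = g n) -> f = g.
Proof. by case: f g => [f] [g] /= fg; congr FPS; apply: funext. Qed.

HB.instance Definition _ := gen_eqMixin (fps R).
HB.instance Definition _ := gen_choiceMixin (fps R).

Definition fps_zero : fps R := FPS (fun=> 0).
Definition fps_opp f : fps R := FPS (fun n => - f n).
Definition fps_add f g : fps R := FPS (fun n => f n + g n).
Definition fps_one : fps R := FPS (fun n => (n == 0%N)%:R).
Definition fps_mul f g : fps R := FPS (fun n => \sum_(i < n.+1) f i * g (n - i)%N).

Lemma fps_addA : associative fps_add.
Proof. by move=> f g h; apply: fps_ext => n /=; rewrite addrA. Qed.
Lemma fps_addC : commutative fps_add.
Proof. by move=> f g; apply: fps_ext => n /=; rewrite addrC. Qed.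
Lemma fps_add0 : left_id fps_zero fps_add.
Proof. by move=> f; apply: fps_ext => n /=; rewrite add0r. Qed.
Lemma fps_addN : left_inverse fps_zero fps_opp fps_add.
Proof. by move=> f; apply: fps_ext => n /=; rewrite addNr. Qed.

HB.instance Definition _ :=
  GRing.isZmodule.Build (fps R) fps_addA fps_addC fps_add0 fps_addN.

Definition fps_trunc N f : {poly R} := \poly_(i < N) f i.

Lemma fps_mul_trunc N f g n :
  (n < N)%N -> fps_mul f g n = (fps_trunc N f * fps_trunc N g)`_n.
Proof.
move=> nN; rewrite coefM /=; apply: eq_bigr => i _.
rewrite !coef_poly (leq_ltn_trans _ nN) ?leq_ord //.
by rewrite (leq_ltn_trans (leq_subr _ _) nN).
Qed.

Lemma fps_mulC : commutative fps_mul.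
Proof.
by move=> f g; apply: fps_ext => n; rewrite (fps_mul_trunc f _ (ltnSn n)) (fps_mul_trunc g _ (ltnSn n)) mulrC.
Qed.

Lemma fps_mulA : associative fps_mul.
Proof.
have H f g h n : fps_mul (fps_mul f g) h n =
    (fps_trunc n.+1 f * fps_trunc n.+1 g * fps_trunc n.+1 h)`_n.
  rewrite coefM; apply: eq_bigr => i _.
  by rewrite (@fps_mul_trunc n.+1) // coef_poly ltnS leq_subr.
move=> f g h; apply: fps_ext => n; rewrite H.
by rewrite fps_mulC H mulrC mulrA.
Qed.

Lemma fps_mul1 : left_id fps_one fps_mul.
Proof.
move=> f; apply: fps_ext => n /=; rewrite big_ord_recl /= mul1r subn0.
by rewrite big1 ?addr0 // => i _; rewrite mul0r.
Qed.

Lemma fps_mulD : left_distributive fps_mul fps_add.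
Proof.
move=> f g h; apply: fps_ext => n /=; rewrite -big_split /=.
by apply: eq_bigr => i _; rewrite mulrDl.
Qed.

Lemma fps_one_neq0 : fps_one != fps_zero.
Proof. by apply/eqP => /(congr1 (fun f => fps_coef f 0%N))/eqP; rewrite oner_eq0. Qed.

HB.instance Definition _ := GRing.Zmodule_isComNzRing.Build (fps R)
  fps_mulA fps_mulC fps_mul1 fps_mulD fps_one_neq0.

Fixpoint fps_inv_seq f n : seq R :=
  if n is m.+1 then
    let s := fps_inv_seq f m in
    rcons s ((f 0%N)^-1 * ((m == 0%N)%:R - \sum_(i < m) s`_i * f (m - i)%N))
  else [::].

Definition fps_unit : pred (fps R) := fun f => f 0%N \is a GRing.unit.

Definition fps_inv f : fps R :=
  if fps_unit f then FPS (fun n => (fps_inv_seq f n.+1)`_n) else f.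

Lemma size_fps_inv_seq f n : size (fps_inv_seq f n) = n.
Proof. by elim: n => //= n IH; rewrite size_rcons IH. Qed.

Lemma nth_fps_inv_seq f n i :
  (i < n)%N -> (fps_inv_seq f n)`_i = (fps_inv_seq f i.+1)`_i.
Proof.
elim: n => // n IH; rewrite ltnS leq_eqVlt => /orP[/eqP-> // | lt_in].
by rewrite [LHS]/= nth_rcons size_fps_inv_seq lt_in IH.
Qed.

Lemma fps_mulVx : {in fps_unit, left_inverse 1 fps_inv *%R}.
Proof.
move=> f uf; apply: fps_ext => n.
have -> : (fps_inv f * f) n =
    \sum_(i < n.+1) (fps_inv_seq f i.+1)`_i * f (n - i)%N.
  by rewrite /fps_inv ifT.
have lastE : (fps_inv_seq f n.+1)`_n = (f 0%N)^-1 *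
    ((n == 0%N)%:R - \sum_(i < n) (fps_inv_seq f i.+1)`_i * f (n - i)%N).
  rewrite [LHS]/= nth_rcons size_fps_inv_seq ltnn eqxx.
  congr (_ * (_ - _)); apply: eq_bigr => i _.
  by rewrite nth_fps_inv_seq.
rewrite big_ord_recr [nat_of_ord ord_max]/= lastE subnn mulrAC mulVr // mul1r.
by rewrite /= addrC subrK.
Qed.

Lemma fps_unitPl f g : g * f = 1 -> fps_unit f.
Proof.
move=> /(congr1 (fun h => fps_coef h 0%N)); rewrite /= big_ord1 subnn => gf1.
by apply/unitrP; exists (g 0%N); rewrite [f _ * _]mulrC gf1.
Qed.

Lemma fps_inv_out : {in [predC fps_unit], fps_inv =1 id}.
Proof. by move=> f nuf; rewrite /fps_inv ifF //; apply: negbTE. Qed.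

HB.instance Definition _ := GRing.ComNzRing_hasMulInverse.Build (fps R)
  fps_mulVx fps_unitPl fps_inv_out.

End FormalPowerSeries.

(** The boundary points of a diagram from [t] to [n]: bottom points are [inl i],
    top points are [inr j], both numbered from left to right. *)
Definition bpoint (t n : nat) : Type := ('I_t + 'I_n)%type.
HB.instance Definition _ t n := Finite.on (bpoint t n).

(** Position of a point when the boundary rectangle is traversed anticlockwise
    from the bottom left corner. *)
Definition bpos t n (x : bpoint t n) : nat :=
  match x with inl i => i | inr j => (t + (n - j.+1))%N end.

Definition is_tl t n (f : {ffun bpoint t n -> bpoint t n}) : bool :=
  [&& [forall x, f (f x) == x],
      [forall x, f x != x] &
      [forall x, forall y, ~~ [&& (bpos x < bpos y)%N,
         (bpos y < bpos (f x))%N & (bpos (f x) < bpos (f y))%N]]].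

Record tl_diagram t n := TLDiagram {
  tl_pair :> {ffun bpoint t n -> bpoint t n};
  tl_pairP : is_tl tl_pair }.

HB.instance Definition _ t n := [isSub for @tl_pair t n].
HB.instance Definition _ t n := [Finite of tl_diagram t n by <:].

Lemma tl_id_subproof t :
  is_tl [ffun x : bpoint t t => match x with inl i => inr i | inr i => inl i end].
Proof.
apply/and3P; split; apply/forallP.
- by move=> [i|i]; rewrite !ffunE.
- by move=> [i|i]; rewrite !ffunE.
move=> x; apply/forallP => y; rewrite !ffunE.
by case: x y => [i|i] [j|j] /=; have := ltn_ord i; have := ltn_ord j; lia.
Qed.
Definition tl_id t : tl_diagram t t := TLDiagram (tl_id_subproof t).

Definition bflip t n (x : bpoint t n) : bpoint n t :=
  match x with inl i => inr i | inr j => inl j end.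

Lemma bflipK t n : cancel (@bflip t n) (@bflip n t).
Proof. by case. Qed.

Lemma bpos_flip t n (x : bpoint t n) : bpos (bflip x) = (t + n - (bpos x).+1)%N.
Proof. by case: x => i /=; have := ltn_ord i; lia. Qed.

Lemma bpos_lt t n (x : bpoint t n) : (bpos x < t + n)%N.
Proof. by case: x => i /=; have := ltn_ord i; lia. Qed.

Lemma tl_reflect_subproof t n (D : tl_diagram t n) :
  is_tl [ffun x : bpoint n t => bflip (D (bflip x))].
Proof.
have /and3P[/forallP DK /forallP Dx /forallP Dnc] := tl_pairP D.
apply/and3P; split; apply/forallP => x; rewrite ?ffunE.
- by rewrite ?ffunE bflipK (eqP (DK _)) bflipK.
- by apply: contra (Dx (bflip x)) => /eqP {2}<-; rewrite bflipK.
apply/forallP => y; rewrite !ffunE.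
have := forallP (Dnc (D (bflip y))) (D (bflip x)).
rewrite !(eqP (DK _)) !bpos_flip.
have := bpos_lt x; have := bpos_lt y.
have := bpos_lt (D (bflip x)); have := bpos_lt (D (bflip y)).
by lia.
Qed.
Definition tl_reflect t n (D : tl_diagram t n) : tl_diagram n t :=
  TLDiagram (tl_reflect_subproof D).

Definition monic t n (D : tl_diagram t n) : bool :=
  [forall i : 'I_t, if D (inl i) is inr _ then true else false].

(** [E : m -> n] is stacked on top of [D : t -> m]. *)

Section Stacking.
Variables (t m n : nat) (E : tl_diagram m n) (D : tl_diagram t m).

(** The points of the stacked picture, from bottom to top; those of the middle
    line are shared by [D] and [E]. *)
Definition spoint : Type := ('I_t + 'I_m + 'I_n)%type.
HB.instance Definition _ := Finite.on spoint.

Definition of_lower (x : bpoint t m) : spoint := inl x.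
Definition of_upper (x : bpoint m n) : spoint :=
  match x with inl k => inl (inr k) | inr j => inr j end.
Definition of_outer (x : bpoint t n) : spoint :=
  match x with inl i => inl (inl i) | inr j => inr j end.

Definition stack_arc : rel spoint := fun u v =>
  [exists x, (u == of_lower x) && (v == of_lower (D x))]
  || [exists x, (u == of_upper x) && (v == of_upper (E x))].

(** The component of an outer point is a path with exactly two outer endpoints,
    so at most one [F] has this property. *)
Definition stacks_to (F : tl_diagram t n) : bool :=
  [forall x, connect stack_arc (of_outer x) (of_outer (F x))].

(** Closed loops are the components that do not reach the boundary. *)
Definition stack_loops : nat :=
  n_comp stack_arc [pred u | [forall x, ~~ connect stack_arc u (of_outer x)]].

(** The composite of [E] and [D] is [delta ^+ stack_loops] times the diagram
    obtained by joining; this is its coefficient at [F]. *)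
Definition stack_coef (K : fieldType) (delta : K) (F : tl_diagram t n) : K :=
  if stacks_to F then delta ^+ stack_loops else 0.

End Stacking.

Section TemperleyLieb.
Variables (K : fieldType) (q : K).

Definition loop_value : K := - (q + q^-1).

(** Formal linear combinations of diagrams; [tl_hom n n] with [tl_comp] is the
    algebra TL_n(q). *)
Definition tl_hom t n := {ffun tl_diagram t n -> K^o}.

Definition tl_comp t m n (g : tl_hom m n) (f : tl_hom t m) : tl_hom t n :=
  [ffun F => \sum_E \sum_D g E * f D * stack_coef E D loop_value F].

Definition monic_diagram t n := {D : tl_diagram t n | monic D}.

Definition cell t n := {ffun monic_diagram t n -> K^o}.
HB.instance Definition _ t n := Vector.on (cell t n).

(** The sum ranges over monic [D] and only monic [M] are kept: the non-monic part
    of the composite is discarded. *)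
Definition cell_act t n (x : tl_hom n n) (w : cell t n) : cell t n :=
  [ffun M => \sum_E \sum_D
     x E * w D * stack_coef E (val D) loop_value (val M)].

(** The composite of two diagrams is a multiple of a single diagram, so this is
    the scalar in front of the identity, and 0 if another diagram appears. *)
Definition cell_gram t n (D1 D2 : monic_diagram t n) : K :=
  stack_coef (tl_reflect (val D1)) (val D2) loop_value (tl_id t).

Definition cell_form t n (u v : cell t n) : K :=
  \sum_D1 \sum_D2 u D1 * v D2 * cell_gram D1 D2.

Definition cell_form_ffun t n (u : cell t n) : cell t n :=
  [ffun D2 => \sum_D1 u D1 * cell_gram D1 D2].

Lemma cell_form_ffun_linear t n : linear (@cell_form_ffun t n).
Proof.
move=> k u v; apply/ffunP => D; rewrite !ffunE scaler_sumr -big_split /=.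
by apply: eq_bigr => D1 _; rewrite !ffunE mulrDl -scalerAl.
Qed.
HB.instance Definition _ t n :=
  GRing.isLinear.Build K (cell t n) (cell t n) _ _ (@cell_form_ffun_linear t n).

Definition cell_rad t n : {vspace cell t n} := lker (linfun (@cell_form_ffun t n)).

Lemma cell_radP t n (u : cell t n) :
  reflect (forall v, cell_form u v = 0) (u \in cell_rad t n).
Proof.
have E v : cell_form u v = \sum_D v D * cell_form_ffun u D.
  rewrite /cell_form exchange_big; apply: eq_bigr => D _.
  by rewrite ffunE mulr_sumr; apply: eq_bigr => D' _; rewrite mulrCA mulrA.
rewrite memv_ker lfunE /=; apply: (iffP eqP) => [u0 v | u0].
  by rewrite E u0 big1 // => D _; rewrite ffunE mulr0.
apply/ffunP => D; have := u0 [ffun D' => (D' == D)%:R : K^o].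
rewrite E (bigD1 D) //= ffunE eqxx mul1r big1 ?addr0 => [->|D' /negPf neq].
  by rewrite ffunE.
by rewrite ffunE neq mul0r.
Qed.

Definition simple_quotient t n := quotv (cell_rad t n).
HB.instance Definition _ t n := Vector.on (simple_quotient t n).

Definition simple_series t : fps rat :=
  FPS (fun k => (\dim {: simple_quotient t (t + 2 * k)})%:R).

End TemperleyLieb.

Definition catalan : fps rat :=
  FPS (fun n => (n.+1)%:R^-1 * 'C(2 * n, n)%:R).

(** The value at [0] is a dummy: the recursion starts at [1] and [2]. *)
Fixpoint jones_poly (i : nat) : {poly int} :=
  match i with
  | 0%N => 0
  | 1%N => 1
  | 2%N => 1
  | ((_.+1 as j).+1 as k).+1 => jones_poly k - 'X * jones_poly j
  end.

Definition fps_of_poly (p : {poly int}) : fps rat := FPS (fun n => (p`_n)%:~R).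

(* Main.v *)
From HB Require Import structures.
Require Import Defs.
From mathcomp Require Import all_boot all_order all_algebra.
From mathcomp Require Import boolp reals complex zify ring.

Set Implicit Arguments.
Unset Strict Implicit.
Unset Printing Implicit Defensive.

Import GRing.Theory Num.Theory.

(** Choose [s] with [s ^ 2 = - q] and let a cup act on a two-dimensional space [V]
    with basis [e1, e2] as [s e1 (x) e2 + s^-1 e2 (x) e1].  A monic diagram
    [t -> n] then maps [e1^(x)t] to a vector of [V^(x)n], and the bilinear form on
    the cell module is the restriction of the standard form of [V^(x)n] to these
    vectors; this is proved by straightening one arc of the overlay of two diagrams
    at a time.

    Splitting off one top point divides the diagrams [t -> n+1] into those coming
    from [t-1 -> n] and those coming from [t+1 -> n].  If the quantum integer [t+1]
    is nonzero, the lowering operator of quantum sl2 yields a unitriangular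
    congruence from the Gram matrix [G_t(n+1)] to the direct sum of [G_(t-1)(n)]
    and [([t+2]/[t+1]) G_(t+1)(n)], hence the recursion for the ranks away from the
    walls [ell | t+1].  On a wall the Gram matrix is invertible: its determinant is
    a polynomial in the loop value, the same recursion gives the multiplicity of the
    critical loop value as a root, and this multiplicity vanishes when [ell | t+1].
    The resulting recursion for the ranks is the one satisfied by the coefficients of
    the right-hand side. *)

(** * Noncrossing matchings and words *)

(** Two obstacles shape the proof. Straightening an overlay adds a loop instead of removing one, so
    the loop value has to be cancelled afterwards; it is nonzero because [ell >= 4] excludes
    [q ^ 2 = -1]. The splitting of the Gram matrix divides by [[t+1]], so at a wall only the
    determinant identity with cleared denominators survives, and multiplicities of a root have to
    replace values. The shape of the answer comes from the walls. Write [t = a ell + b]. For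
    [b = ell - 2] the block of [t+1] has coefficient 0, so nothing enters the strip from its right
    wall. For [b = 0] and [a > 0] the block of [t-1] lies on the left wall, where the rank is the
    full dimension of the cell module, with series [c ^ (a ell)]. Between the walls the recursion in
    [b] is that of the polynomials [p_i], and the boundary values [p_ell / p_ell = 1] on the left
    and 0 on the right select [p_(ell-1-b) / p_ell]. *)

(* A diagram is read along its top line from right to left; [true] opens an arc
   (push), [false] closes one (pop), and the height counts the open arcs, which
   initially are the [t] through lines. *)
Fixpoint nwords n t : nat :=
  if n is n'.+1 then ((if t is t'.+1 then nwords n' t' else 0) + nwords n' t.+1)%N
  else (t == 0%N).

Definition npop n t : nat := if t is t'.+1 then nwords n t' else 0%N.

Fixpoint ncolorings n : nat :=
  if n is n'.+1 then (ncolorings n' + ncolorings n')%N else 1%N.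

Definition between (i j k : nat) := (i < k < j) || (j < k < i).

Record matching (N : nat) (m : nat -> nat) : Prop := Matching {
  matching_lt : forall k, k < N -> m k < N;
  matchingK : forall k, k < N -> m (m k) = k;
  matching_neq : forall k, k < N -> m k <> k;
  matching_nc : forall i j, i < N -> j < N -> i < j < m i -> i < m j < m i }.

Definition letters (m : nat -> nat) k l := [seq j < m j | j <- iota k l].

Fixpoint valid_word (h : nat) (w : seq bool) : bool :=
  match w with
  | [::] => h == 0
  | true :: w' => valid_word h.+1 w'
  | false :: w' => (0 < h) && valid_word h.-1 w'
  end.

Section Stack.
Variables (N : nat) (m : nat -> nat).
Hypothesis Hm : matching N m.

(* Listed from right to left: the open point to be closed next comes first. *)
Definition open_points k := [seq p <- rev (iota 0 k) | k <= m p].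

Lemma open_push k : k < N -> k < m k -> open_points k.+1 = k :: open_points k.
Proof.
move=> kN km; rewrite /open_points -[k.+1]addn1 iotaD rev_cat /= add0n addn1 km.
congr cons; apply: eq_in_filter => p; rewrite mem_rev mem_iota /= => pk.
have := matchingK Hm kN; have : m p <> k; last lia.
by move=> mp; have := matchingK Hm (ltn_trans pk kN); rewrite mp; lia.
Qed.

(** Noncrossing is what makes a stack sufficient: the points strictly between [m k] and [k] are
    matched among themselves, so [m k] is the most recent open point. *)
Lemma open_pop k : k < N -> m k < k -> open_points k = m k :: open_points k.+1.
Proof.
move=> kN mk; have mkN := ltn_trans mk kN.
have E : open_points k.+1 = [seq p <- rev (iota 0 k) | k < m p].
  by rewrite /open_points -[k.+1]addn1 iotaD rev_cat /= add0n addn1 ltnNge (ltnW mk).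
rewrite E /open_points.
have -> : iota 0 k = iota 0 (m k) ++ m k :: iota (m k).+1 (k - (m k).+1).
  by have := iotaD 0 (m k) (k - m k).-1.+1; rewrite add0n /=;
    (have -> : m k + (k - m k).-1.+1 = k by lia); move=> ->; congr (_ ++ _ :: iota _ _); lia.
rewrite rev_cat rev_cons -cats1 !filter_cat /= (matchingK Hm kN) leqnn ltnn.
have out p : m k < p < k -> (k <= m p) = false.
  move=> pk; have := @matching_nc _ _ Hm (m k) p mkN; rewrite (matchingK Hm kN); lia.
have F0 (P : pred nat) : (forall p, m k < p < k -> P p = false) ->
    [seq p <- rev (iota (m k).+1 (k - (m k).+1)) | P p] = [::].
  move=> PF; rewrite (eq_in_filter (a2 := pred0)) ?filter_pred0 // => p.
  by rewrite mem_rev mem_iota => pk; apply: PF; lia.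
rewrite (F0 (fun p => k <= m p)) // (F0 (fun p => k < m p)) => [|p /out]; last lia.
rewrite /=; congr cons; apply: eq_in_filter => p; rewrite mem_rev mem_iota /= => pk.
have : m p <> k; last lia.
by move=> mp; have := matchingK Hm (ltn_trans pk mkN); rewrite mp; lia.
Qed.

Lemma open_last : open_points N = [::].
Proof.
rewrite /open_points (eq_in_filter (a2 := pred0)) ?filter_pred0 // => p.
by rewrite mem_rev mem_iota /= => pN; have := matching_lt Hm pN; lia.
Qed.

Lemma valid_letters k : k <= N -> valid_word (size (open_points k)) (letters m k (N - k)).
Proof.
move=> kN; have [l lE] : exists l, l = N - k by exists (N - k).
rewrite -lE; elim: l k kN lE => [|l IH] k kN lE.
  have -> : k = N by lia.
  by rewrite open_last.
have kN' : k < N by lia.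
rewrite /=; have [km|mk] := boolP (k < m k).
  by have := IH k.+1 kN'; rewrite open_push //=; apply; lia.
have mk' : m k < k by have := matching_neq Hm kN'; lia.
by rewrite (open_pop kN' mk') /=; apply: IH; lia.
Qed.

End Stack.

(** Induction on the closing point [k]. If [m k < m' k], then [m' k] opens inside the arc of [m]
    ending at [k], so [m] closes it at some [j < k]; there both matchings agree already, and [m']
    would pair [m' k] with both [j] and [k]. *)
Lemma matching_unique N m m' : matching N m -> matching N m' ->
  (forall k, k < N -> (k < m k) = (k < m' k)) -> forall k, k < N -> m k = m' k.
Proof.
move=> Hm Hm' E.
have pops k : k < N -> m k < k -> m k = m' k.
  elim/ltn_ind: k => k IH kN mk.
  have wl m1 m2 : matching N m1 -> matching N m2 ->
      (forall j, j < N -> (j < m1 j) = (j < m2 j)) ->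
      (forall j, j < k -> j < N -> m1 j < j -> m1 j = m2 j) ->
      m1 k < k -> m1 k < m2 k -> m2 k < k -> False.
    move=> H1 H2 E12 IH' k1 k12 k2.
    have k2N : m2 k < N by lia.
    have k1N : m1 k < N by lia.
    have := E12 _ k2N; rewrite (matchingK H2) // k2 => p1.
    have := @matching_nc _ _ H1 (m1 k) (m2 k) k1N k2N; rewrite (matchingK H1) // k12 k2.
    move=> /(_ isT) p2; have := IH' (m1 (m2 k)); rewrite (matchingK H1) // => e3.
    have jN : m1 (m2 k) < N by lia.
    have e4 : m2 k = m2 (m1 (m2 k)) by apply: e3; lia.
    have := matchingK H2 kN; have := matchingK H2 jN; rewrite -e4; lia.
  have m'k : m' k < k.
    by have := E k kN; have := matching_neq Hm' kN; lia.
  case: (ltngtP (m k) (m' k)) => // lt.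
    by case: (wl m m').
  case: (wl m' m) => // [j jN|j jk jN m'j]; first by rewrite E.
  by apply/esym/IH => //; have := E j jN; have := matching_neq Hm jN; lia.
move=> k kN; have [mk|km] := ltnP (m k) k; first exact: pops.
have mkN := matching_lt Hm kN.
have e : m (m k) = m' (m k).
  by apply: pops => //; rewrite (matchingK Hm) //; have := matching_neq Hm kN; lia.
by rewrite -[LHS](matchingK Hm') // -e (matchingK Hm).
Qed.

Lemma matching_exists t w : valid_word t w -> exists m,
  [/\ matching (t + size w) m, letters m t (size w) = w & forall p, p < t -> t <= m p].
Proof.
elim: w t => [|[] w IH] t /=.
- by move/eqP->; exists id; split=> //; split=> // k; rewrite ltn0.
- move=> /IH[m [Hm Hl Ht]]; exists m; rewrite -addSnnS; split=> //.
    by rewrite /letters /= -/(letters _ _ _) Hl Ht.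
  by move=> p pt; apply/ltnW/Ht; lia.
case: t => // t /IH[m [Hm Hl Ht]].
(* The first pop joins the neighbouring positions [t] and [t.+1]. [dn] deletes these two positions
   and [up] reinserts them. *)
pose up i := if i < t then i else i.+2.
pose dn i := if i < t then i else i.-2.
exists (fun k => if k == t then t.+1 else if k == t.+1 then t else up (m (dn k))).
have Hup i : (i < t /\ up i = i) \/ (t <= i /\ up i = i + 2).
  by rewrite /up; case: (ltnP i t); lia.
have Hdn k : (k < t /\ dn k = k) \/ (t <= k /\ dn k = k - 2).
  by rewrite /dn; case: (ltnP k t); lia.
have dnN k : k <> t -> k <> t.+1 -> k < t.+1 + (size w).+1 -> dn k < t + size w.
  by have := Hdn k; lia.
clearbody up dn; split.
- split.
  + move=> k kN; case: eqP => [|kt]; first lia; case: eqP => [|kt']; first lia.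
    by have := matching_lt Hm (dnN k kt kt' kN); have := Hup (m (dn k)); lia.
  + move=> k kN; case: (eqVneq k t) => [->|/eqP kt]; first by rewrite eqxx; case: eqP; lia.
    case: (eqVneq k t.+1) => [->|/eqP kt']; first by rewrite eqxx.
    have := matchingK Hm (dnN k kt kt' kN).
    have upt i : (up i == t) = false by have := Hup i; lia.
    have upt' i : (up i == t.+1) = false by have := Hup i; lia.
    have updn i : dn (up i) = i by have := Hup i; have := Hdn (up i); lia.
    by rewrite upt upt' updn => ->; have := Hup (dn k); have := Hdn k; lia.
  + move=> k kN; case: eqP => [|kt]; first lia; case: eqP => [|kt']; first lia.
    have := matching_neq Hm (dnN k kt kt' kN).
    by have := Hup (m (dn k)); have := Hdn k; lia.
  + move=> i j iN jN.
    case: (eqVneq i t) => [->|/eqP it]; first lia.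
    case: (eqVneq i t.+1) => [->|/eqP it']; first lia.
    have := Hup (m (dn i)); have := Hdn i.
    case: (eqVneq j t) => [->|/eqP jt]; first lia.
    case: (eqVneq j t.+1) => [->|/eqP jt']; first lia.
    have := @matching_nc _ _ Hm _ _ (dnN i it it' iN) (dnN j jt jt' jN).
    by have := Hup (m (dn j)); have := Hdn j; lia.
- rewrite /letters /= eqn_leq ltnn /= eqxx; congr (_ :: _); first by rewrite ltnNge leqnSn.
  rewrite -[RHS]Hl -[t.+2]/(2 + t) iotaDl -map_comp; apply/eq_in_map => k /=.
  rewrite mem_iota => /andP[tk _].
  have -> : (2 + k == t) = false by lia.
  have -> : (2 + k == t.+1) = false by lia.
  have -> : dn (2 + k) = k by have := Hdn (2 + k); lia.
  by have := Hup (m k); lia.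
move=> p pt; case: eqP => // pt'; case: eqP => [|_]; first lia.
have pt2 : p < t by lia.
have -> : dn p = p by have := Hdn p; lia.
by have := Ht _ pt2; have := Hup (m p); lia.
Qed.

Fixpoint words n t : seq (seq bool) :=
  if n is n'.+1 then
    (if t is t'.+1 then map (cons false) (words n' t') else [::])
      ++ map (cons true) (words n' t.+1)
  else if t == 0 then [:: [::]] else [::].

Lemma size_words n t : size (words n t) = nwords n t.
Proof.
elim: n t => [|n IH] [|t] //=; rewrite ?size_cat !size_map !IH //.
Qed.

Lemma mem_words n t w : (w \in words n t) = (size w == n) && valid_word t w.
Proof.
elim: n t w => [|n IH] t w.
  by case: t w => [|t] [|[] w].
have mm (c : bool) (W : seq (seq bool)) :
    (w \in map (cons c) W) = if w is c' :: w' then (c' == c) && (w' \in W) else false.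
  case: w => [|c' w]; first by apply/mapP => -[].
  apply/mapP/andP => [[w' w'W [-> ->]]|[/eqP-> wW]]; first by rewrite eqxx.
  by exists w.
rewrite /= mem_cat; case: t => [|t]; rewrite ?mm; case: w {mm} => [|[] w] //=;
  by rewrite ?orbF ?IH ?eqSS ?andbF.
Qed.

Lemma words_uniq n t : uniq (words n t).
Proof.
have inj c : injective (cons c : seq bool -> _) by move=> ? ? [].
elim: n t => [|n IH] t /=; first by case: eqP.
rewrite cat_uniq !map_inj_uniq // IH andbT; case: t => [|t] /=.
  by apply/hasPn.
rewrite map_inj_uniq // IH /=; apply/hasPn => _ /mapP[w _ ->].
by apply/mapP => -[].
Qed.

Fixpoint colorings n : seq (seq bool) :=
  if n is n'.+1 then map (cons true) (colorings n') ++ map (cons false) (colorings n')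
  else [:: [::]].

Lemma size_colorings n : size (colorings n) = ncolorings n.
Proof. by elim: n => //= n IH; rewrite size_cat !size_map !IH. Qed.


(** * Rewiring one of two involutions *)

Section Surgery.
Variables (X : finType) (sg ta : X -> X).

Definition two_step (f g : X -> X) : rel X := fun u v => (v == f u) || (v == g u).

Lemma two_step_sym f g : involutive f -> involutive g ->
  connect_sym (two_step f g).
Proof.
move=> fK gK; apply: sym_connect_sym => u v; rewrite /two_step.
by congr (_ || _); apply/eqP/eqP => ->; rewrite ?fK ?gK.
Qed.

(* Cut the links of [a] and [b], join [a] to [b] and their former partners to each
   other. If the other involution also links [a] to [b], this splits off a loop. *)
Definition rewire (f : X -> X) (a b u : X) : X :=
  if u == a then b else if u == b then a
  else if u == f a then f b else if u == f b then f a else f u.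

Variables a b : X.
Hypotheses (sgK : involutive sg) (taK : involutive ta).
Hypotheses (sga : sg a = b) (ab : a != b).
Hypotheses (taa : ta a != a) (tab : ta a != b) (tbb : ta b != b).

Let tba : ta b != a. Proof. by apply: contra tab => /eqP<-; rewrite taK. Qed.
Let sgb : sg b = a. Proof. by rewrite -sga sgK. Qed.
Let taE u v : (u == ta v) = (ta u == v).
Proof. by apply/eqP/eqP => [->|<-]; rewrite taK. Qed.

Lemma rewireK : involutive (rewire ta a b).
Proof.
have tt : ta b != ta a by rewrite (inj_eq (can_inj taK)) eq_sym.
move=> u; rewrite /rewire.
have [->|ua] := eqVneq u a; first by rewrite eqxx eq_sym (negPf ab).
have [->|ub] := eqVneq u b; first by rewrite eqxx.
have [->|uta] := eqVneq u (ta a).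
  by rewrite (negPf tba) (negPf tbb) (negPf tt) eqxx.
have [->|utb] := eqVneq u (ta b).
  by rewrite (negPf taa) (negPf tab) eqxx.
by rewrite -[ta u == a]taE -[ta u == b]taE (negPf uta) (negPf utb)
  !(inj_eq (can_inj taK)) (negPf ua) (negPf ub) taK.
Qed.

Lemma rewire_neq u : ta u != u -> rewire ta a b u != u.
Proof.
move=> tu; rewrite /rewire; have [->|ua] := eqVneq u a; first by rewrite eq_sym.
have [->|ub] := eqVneq u b; first by [].
have [->|uta] := eqVneq u (ta a); first by rewrite (inj_eq (can_inj taK)) eq_sym.
by have [->|utb] := eqVneq u (ta b); rewrite ?(inj_eq (can_inj taK)).
Qed.

Local Notation e := (two_step sg ta).
Local Notation e' := (two_step sg (rewire ta a b)).
Let esym := two_step_sym sgK taK.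
Let e'sym := two_step_sym sgK rewireK.

(** Rewiring isolates [a] and [b] in a loop of their own. Old and new connectivity are compared by
    first moving these two points to neighbours that stay in their old component. *)
Definition retract (u : X) : X := if u == a then ta a else if u == b then ta b else u.

Lemma retract_id u : u != a -> u != b -> retract u = u.
Proof. by rewrite /retract => /negPf-> /negPf->. Qed.

Lemma retract_out u : retract u != a /\ retract u != b.
Proof.
rewrite /retract; have [_|ua] := eqVneq u a; first by split.
by have [_|ub] := eqVneq u b; split.
Qed.

Lemma connect_retract u : connect e u (retract u).
Proof.
rewrite /retract; have [->|ua] := eqVneq u a; first by rewrite connect1 // /two_step eqxx orbT.
by have [->|ub] := eqVneq u b; rewrite ?connect0 // connect1 // /two_step eqxx orbT.
Qed.

Lemma connect_tab : connect e (ta a) (ta b).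
Proof.
rewrite (same_connect esym (_ : connect e (ta a) a)); last first.
  by rewrite esym connect1 // /two_step eqxx orbT.
rewrite (same_connect esym (_ : connect e a b)); last first.
  by rewrite connect1 // /two_step sga eqxx.
by rewrite connect1 // /two_step eqxx orbT.
Qed.

Lemma sg_out u : u != a -> u != b -> sg u != a /\ sg u != b.
Proof.
by split; [rewrite -[X in _ != X]sgb | rewrite -[X in _ != X]sga];
  rewrite (inj_eq (can_inj sgK)).
Qed.

Lemma connect_rewire_sub u v : u != a -> u != b -> connect e' u v ->
  [/\ connect e u v, v != a & v != b].
Proof.
move=> ua ub /connectP[p]; elim: p u ua ub => [|w p IH] u ua ub /=; first by move=> _ ->.
case/andP=> uw pw vE.
have [wa wb cuw] : [/\ w != a, w != b & connect e u w].
  case/orP: uw => /eqP->.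
    have [sa sb] := sg_out ua ub; split=> //.
    by rewrite connect1 // /two_step eqxx.
  rewrite /rewire (negPf ua) (negPf ub).
  have [->|uta] := eqVneq u (ta a); first by split; rewrite ?connect_tab.
  have [->|utb] := eqVneq u (ta b); first by split; rewrite // esym connect_tab.
  by rewrite -!taE uta utb; split=> //; rewrite connect1 // /two_step eqxx orbT.
have [cwv va vb] := IH _ wa wb pw vE; split=> //; exact: connect_trans cwv.
Qed.

Lemma step_retract u v : e u v -> connect e' (retract u) (retract v).
Proof.
have C : connect e' (ta a) (ta b).
  rewrite connect1 // /two_step /rewire.
  by rewrite (negPf taa) (negPf tab) !eqxx orbT.
case/orP=> /eqP->.
  have [->|ua] := eqVneq u a.
    by rewrite sga /retract eqxx eq_sym (negPf ab) eqxx.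
  have [->|ub] := eqVneq u b.
    by rewrite sgb /retract eqxx eq_sym (negPf ab) eqxx e'sym.
  have [sa sb] := sg_out ua ub.
  by rewrite !retract_id // connect1 // /two_step eqxx.
have [->|ua] := eqVneq u a.
  by rewrite (retract_id taa tab) /retract eqxx.
have [->|ub] := eqVneq u b.
  by rewrite (retract_id tba tbb) /retract eqxx eq_sym (negPf ab).
have [->|uta] := eqVneq u (ta a).
  by rewrite taK (retract_id taa tab) /retract eqxx.
have [->|utb] := eqVneq u (ta b).
  by rewrite taK (retract_id tba tbb) /retract eqxx eq_sym (negPf ab).
rewrite !retract_id -?taE // connect1 // /two_step /rewire.
by rewrite (negPf ua) (negPf ub) (negPf uta) (negPf utb) eqxx orbT.
Qed.

Lemma connect_rewire u v : connect e u v = connect e' (retract u) (retract v).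
Proof.
apply/idP/idP.
  move=> /connectP[p]; elim: p u => [|w p IH] u /=; first by move=> _ ->.
  by case/andP=> /step_retract uw pw vE; apply: connect_trans uw (IH _ pw vE).
have [ua ub] := retract_out u => /(connect_rewire_sub ua ub)[c _ _].
apply: connect_trans (connect_retract u) _.
by apply: connect_trans c _; rewrite esym connect_retract.
Qed.

Lemma connect_rewire_out u v : u != a -> u != b -> v != a -> v != b ->
  connect e u v = connect e' u v.
Proof. by move=> ua ub va vb; rewrite connect_rewire !retract_id. Qed.

Lemma connect_rewire_loop u : connect e' a u = (u == a) || (u == b).
Proof.
apply/idP/idP => [|/orP[/eqP->|/eqP->] //]; last first.
  by rewrite connect1 // /two_step sga eqxx.
apply: contraLR; rewrite negb_or => /andP[ua ub].
by rewrite e'sym; apply/negP => /(connect_rewire_sub ua ub)[_]; rewrite eqxx.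
Qed.

Variables (I : finType) (f : I -> X).
Hypotheses (fa : forall i, f i != a) (fb : forall i, f i != b).

Definition off_boundary (r : rel X) : pred X := [pred u | [forall i, ~~ connect r u (f i)]].

Lemma off_boundary_closed g h : involutive g -> involutive h ->
  closed (two_step g h) (off_boundary (two_step g h)).
Proof.
move=> gK hK u v /connect1 uv; rewrite !inE /=; apply: eq_forallb => i.
by rewrite (same_connect (two_step_sym gK hK) uv).
Qed.

Lemma off_boundary_rewire u : u != a -> u != b ->
  (u \in off_boundary e) = (u \in off_boundary e').
Proof.
by move=> ua ub; rewrite !inE; apply: eq_forallb => i; rewrite connect_rewire_out.
Qed.

Lemma loop_off_boundary u : (u == a) || (u == b) -> u \in off_boundary e'.
Proof.
move=> ul; apply/forallP => i; move: ul; rewrite -connect_rewire_loop => ul.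
by rewrite -(same_connect e'sym ul) connect_rewire_loop negb_or fa fb.
Qed.

(** The new component is the loop of [a] and [b], which meets no boundary point; on the remaining
    closed components [retract] induces a bijection. *)
Lemma rewire_n_comp : n_comp e' (off_boundary e') = (n_comp e (off_boundary e)).+1.
Proof.
pose L := [pred u | (u == a) || (u == b)].
have split_card : n_comp e' (off_boundary e') =
    n_comp e' L + n_comp e' [predD off_boundary e' & L].
  rewrite /n_comp_mem -(cardID L); congr (_ + _); apply: eq_card => u; rewrite !inE /=.
    case: (boolP (_ || _)) => ul; rewrite ?andbF ?andbT //=.
    by have := loop_off_boundary ul; rewrite inE => ->; rewrite andbT.
  by rewrite andbCA.
rewrite split_card -add1n; congr (_ + _).
  rewrite -(n_comp_connect e'sym a); apply: eq_n_comp_r => u.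
  by rewrite [RHS]connect_rewire_loop.
have clA : closed e' [predD off_boundary e' & L].
  move=> u v uv; 
  rewrite -[LHS]/((u \notin L) && (u \in off_boundary e')).
  rewrite -[RHS]/((v \notin L) && (v \in off_boundary e')).
  rewrite (off_boundary_closed sgK rewireK uv) !inE; congr (_ && _).
  by rewrite -!connect_rewire_loop -!(e'sym _ a) (same_connect e'sym (connect1 uv)).
rewrite (adjunction_n_comp retract e'sym esym clA).
  apply: eq_n_comp_r => u; rewrite !inE /=; have [ra rb] := retract_out u.
  rewrite (negPf ra) (negPf rb) /= -[RHS]/(u \in off_boundary e).
  rewrite -[LHS]/(_ \in off_boundary e') -off_boundary_rewire //.
  by rewrite !inE; apply: eq_forallb => i; rewrite (same_connect esym (connect_retract u)).
split=> [u|u v _]; last exact: connect_rewire.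
rewrite !inE negb_or => /andP[/andP[ua ub] _]; exists u; by rewrite retract_id.
Qed.

End Surgery.

(** * Diagrams as matchings *)

Section Positions.
Variables t n : nat.
Implicit Types (p x y : bpoint t n) (D : tl_diagram t n).

Lemma bpos_inj : injective (@bpos t n).
Proof.
case=> i [] j /= e; have hi := ltn_ord i; have hj := ltn_ord j; try lia.
  by congr inl; apply: val_inj.
by congr inr; apply: val_inj => /=; lia.
Qed.

Definition bpoint_at (p0 : bpoint t n) k := odflt p0 [pick p | bpos p == k].

Lemma bpoint_atK p0 p : bpoint_at p0 (bpos p) = p.
Proof.
by rewrite /bpoint_at; case: pickP => [q /eqP/bpos_inj//|/(_ p)]; rewrite eqxx.
Qed.

Lemma bpos_surj k : k < t + n -> exists p, bpos p = k.
Proof.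
move=> kN; have [kt|tk] := ltnP k t; first by exists (inl (Ordinal kt)).
have h : n - (k - t).+1 < n by lia.
by exists (inr (Ordinal h)) => /=; lia.
Qed.

Lemma bpos_at p0 k : k < t + n -> bpos (bpoint_at p0 k) = k.
Proof. by move=> /bpos_surj[p <-]; rewrite bpoint_atK. Qed.

Lemma tl_pairK D : involutive D.
Proof. by move=> x; have /and3P[/forallP/(_ x)/eqP ? _ _] := tl_pairP D. Qed.

Lemma tl_pair_neq D x : D x != x.
Proof. by have /and3P[_ /forallP/(_ x) ? _] := tl_pairP D. Qed.

Definition pair_pos D k := if [pick p | bpos p == k] is Some p then bpos (D p) else 0.

Lemma pair_posE D p : pair_pos D (bpos p) = bpos (D p).
Proof.
by rewrite /pair_pos; case: pickP => [q /eqP/bpos_inj->//|/(_ p)]; rewrite eqxx.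
Qed.

Lemma is_tl_nested D x y :
  bpos x < bpos y < bpos (D x) -> bpos x < bpos (D y) < bpos (D x).
Proof.
have /and3P[_ _ /forallP nc] := tl_pairP D.
move=> xy; have := forallP (nc x) y; have := forallP (nc (D y)) x; rewrite tl_pairK.
have : bpos (D y) <> bpos x by move=> /bpos_inj/(congr1 D); rewrite tl_pairK => yE; subst y; lia.
have : bpos (D y) <> bpos (D x) by move=> /bpos_inj/(can_inj (tl_pairK D)) yE; subst y; lia.
lia.
Qed.

Lemma pair_pos_matching D : matching (t + n) (pair_pos D).
Proof.
split=> [k|k|k|i j].
- by move=> /bpos_surj[p <-]; rewrite pair_posE bpos_lt.
- by move=> /bpos_surj[p <-]; rewrite !pair_posE tl_pairK.
- move=> /bpos_surj[p <-]; rewrite pair_posE => /bpos_inj e.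
  by have := tl_pair_neq D p; rewrite e eqxx.
move=> /bpos_surj[x <-] /bpos_surj[y <-]; rewrite !pair_posE; exact: is_tl_nested.
Qed.

Lemma diagram_of_matching m : matching (t + n) m ->
  exists D, forall k, k < t + n -> pair_pos D k = m k.
Proof.
move=> Hm; pose f := [ffun p : bpoint t n => bpoint_at p (m (bpos p))].
have fE p : bpos (f p) = m (bpos p).
  by rewrite ffunE bpos_at //; apply: (matching_lt Hm); rewrite bpos_lt.
have tlf : is_tl f.
  apply/and3P; split.
  - by apply/forallP => p; apply/eqP/bpos_inj; rewrite !fE (matchingK Hm) ?bpos_lt.
  - apply/forallP => p; apply/eqP => /(congr1 (@bpos t n)); rewrite fE.
    by have := matching_neq Hm (bpos_lt p).
  apply/forallP => x; apply/forallP => y; rewrite !fE.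
  by have := @matching_nc _ _ Hm _ _ (bpos_lt x) (bpos_lt y); lia.
exists (TLDiagram tlf) => k /bpos_surj[p <-]; by rewrite pair_posE fE.
Qed.

Lemma bpos_bottom p : (bpos p < t) = if p is inl _ then true else false.
Proof. by case: p => i /=; have := ltn_ord i; lia. Qed.

Lemma monicE D : Defs.monic D -> forall k, k < t -> t <= pair_pos D k.
Proof.
move=> /forallP mD k kt; rewrite -[k]/(bpos (inl (Ordinal kt) : bpoint t n)) pair_posE leqNgt.
by rewrite bpos_bottom; have := mD (Ordinal kt); case: (D _).
Qed.

Lemma monicI D : (forall k, k < t -> t <= pair_pos D k) -> Defs.monic D.
Proof.
move=> H; apply/forallP => i; have := H (bpos (inl i : bpoint t n)) (ltn_ord i).
by rewrite pair_posE leqNgt bpos_bottom; case: (D _).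
Qed.

Definition word_of D := letters (pair_pos D) t n.

Lemma size_word_of D : size (word_of D) = n.
Proof. by rewrite size_map size_iota. Qed.

Lemma open_points_monic D : Defs.monic D -> open_points (pair_pos D) t = rev (iota 0 t).
Proof.
move=> mD; apply/all_filterP/allP => p; rewrite mem_rev mem_iota /= => pt.
exact: monicE.
Qed.

Lemma word_of_words D : Defs.monic D -> word_of D \in words n t.
Proof.
move=> mD; rewrite mem_words size_word_of eqxx /=.
have := valid_letters (pair_pos_matching D) (leq_addr n t).
by rewrite open_points_monic // size_rev size_iota addKn.
Qed.

Lemma eq_pair_pos D D' : (forall k, k < t + n -> pair_pos D k = pair_pos D' k) -> D = D'.
Proof.
move=> E; apply/val_inj/ffunP => x; apply: bpos_inj.
by have := E _ (bpos_lt x); rewrite !pair_posE.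
Qed.

Lemma diagram_letters_inj D D' :
  (forall x, (bpos x < bpos (D x)) = (bpos x < bpos (D' x))) -> D = D'.
Proof.
move=> E; apply: eq_pair_pos.
apply: matching_unique (pair_pos_matching D) (pair_pos_matching D') _.
by move=> k /bpos_surj[p <-]; rewrite !pair_posE.
Qed.

Lemma word_of_inj D D' : Defs.monic D -> Defs.monic D' -> word_of D = word_of D' -> D = D'.
Proof.
move=> mD mD' E; apply: diagram_letters_inj => x; rewrite -!pair_posE.
have := bpos_lt x; move: (bpos x) => k kN.
have [kt|tk] := ltnP k t.
  by have := monicE mD kt; have := monicE mD' kt; lia.
have := congr1 (fun w => nth false w (k - t)) E.
rewrite /word_of /letters !(nth_map 0) ?size_iota ?nth_iota ?subnKC //; lia.
Qed.

Lemma word_of_surj w : w \in words n t -> exists2 D, Defs.monic D & word_of D = w.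
Proof.
rewrite mem_words => /andP[/eqP sw /matching_exists[m [Hm <- Ht]]].
rewrite sw in Hm *; have [D DE] := diagram_of_matching Hm; exists D.
  by apply: monicI => k kt; rewrite DE ?Ht //; lia.
apply/eq_in_map => k; rewrite mem_iota => kt; rewrite DE //; lia.
Qed.

End Positions.


(** * Planarity of rewired diagrams *)

Section RewireDiagram.
Variables (t n : nat) (D : tl_diagram t n) (a b : bpoint t n).
Hypotheses (ab : bpos a < bpos b) (Dab : D a != b).
Hypothesis inner : forall y, bpos a < bpos y < bpos b -> bpos a < bpos (D y) < bpos b.

Let DK := tl_pairK D.
Let Daa := tl_pair_neq D a.
Let Dbb := tl_pair_neq D b.
Let a_neq_b : a != b. Proof. by apply/eqP => e; move: ab; rewrite e ltnn. Qed.

Lemma between_pair x y : y != x -> y != D x ->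
  between (bpos x) (bpos (D x)) (bpos y) = between (bpos x) (bpos (D x)) (bpos (D y)).
Proof.
move=> yx yDx; rewrite /between.
have nest := @is_tl_nested t n D.
have := nest x y; have := nest (D x) y; have := nest x (D y); have := nest (D x) (D y).
rewrite !DK; lia.
Qed.

Lemma bpos_neq (p q : bpoint t n) : p != q -> bpos p <> bpos q.
Proof. by move=> /eqP pq /bpos_inj. Qed.

Lemma pair_neq_sym (p q : bpoint t n) : p != D q -> D p != q.
Proof. by rewrite -(inj_eq (can_inj DK)) DK. Qed.

Lemma outer_pair : (bpos (D a) < bpos a \/ bpos b < bpos (D a)) /\
  (bpos (D b) < bpos a \/ bpos b < bpos (D b)).
Proof.
have h1 := bpos_neq Daa; have h2 := bpos_neq Dbb; have h3 := bpos_neq Dab.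
have h4 : bpos (D b) <> bpos a by apply/bpos_neq/pair_neq_sym; rewrite eq_sym.
by have := inner (y := D a); have := inner (y := D b); rewrite !DK; lia.
Qed.

(** An arc with [a] and [b] on different sides would have exactly one end in the gap between them,
    which [inner] forbids. Since arcs do not cross, the same then holds for the partners of [a] and
    [b]. *)
Lemma between_gap x : x != a -> x != b -> x != D a -> x != D b ->
  between (bpos x) (bpos (D x)) (bpos a) = between (bpos x) (bpos (D x)) (bpos b).
Proof.
move=> xa xb xDa xDb; rewrite /between.
have h1 := bpos_neq xa; have h2 := bpos_neq xb.
have h3 := bpos_neq (pair_neq_sym xDa); have h4 := bpos_neq (pair_neq_sym xDb).
by have := inner (y := x); have := inner (y := D x); rewrite DK; lia.
Qed.

Lemma between_gap_pair x : x != a -> x != b -> x != D a -> x != D b ->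
  between (bpos x) (bpos (D x)) (bpos (D a)) = between (bpos x) (bpos (D x)) (bpos (D b)).
Proof.
move=> xa xb xDa xDb.
rewrite -!between_pair; first exact: between_gap.
- by rewrite eq_sym.
- by rewrite eq_sym pair_neq_sym.
- by rewrite eq_sym.
- by rewrite eq_sym pair_neq_sym.
Qed.

Local Notation D' := (rewire D a b).

(** Only the arcs [a]-[b] and [D a]-[D b] are new. The first is not crossed because of [inner], the
    second because no other arc separates its ends ([between_gap_pair]). *)
Lemma rewire_nested x y : bpos x < bpos y < bpos (D' x) -> bpos (D' y) <= bpos (D' x).
Proof.
have [out_a out_b] := outer_pair.
have D'a : D' a = b by rewrite /rewire eqxx.
have D'b : D' b = a by rewrite /rewire eqxx eq_sym (negPf a_neq_b).
have Dba : D b != a by rewrite pair_neq_sym // eq_sym.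
have D'Da : D' (D a) = D b by rewrite /rewire (negPf Daa) (negPf Dab) eqxx.
have D'Db : D' (D b) = D a.
  rewrite /rewire (negPf Dba) (negPf Dbb) (inj_eq (can_inj DK)).
  by rewrite eq_sym (negPf a_neq_b) eqxx.
have D'out z : z != a -> z != b -> z != D a -> z != D b -> D' z = D z.
  by rewrite /rewire => /negPf-> /negPf-> /negPf-> /negPf->.
have cases z : [\/ z = a, z = b, z = D a | z = D b] \/
    [/\ z != a, z != b, z != D a & z != D b].
  have [->|za] := eqVneq z a; first by left; constructor.
  have [->|zb] := eqVneq z b; first by left; constructor.
  have [->|zDa] := eqVneq z (D a); first by left; constructor.
  have [->|zDb] := eqVneq z (D b); first by left; constructor.
  by right.
case: (cases x) => [xs|[xa xb xDa xDb]]; case: (cases y) => [ys|[ya yb yDa yDb]].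
- move: ab out_a out_b; clear -D'a D'b D'Da D'Db xs ys.
  by case: xs => ->; case: ys => ->; rewrite ?D'a ?D'b ?D'Da ?D'Db; clear; lia.
- have gap := between_gap_pair ya yb yDa yDb; rewrite (D'out y) //.
  case: xs => ->; rewrite ?D'a ?D'b ?D'Da ?D'Db; last 2 first.
  + by move: gap; rewrite /between; clear; lia.
  + by move: gap; rewrite /between; clear; lia.
  + by have := inner (y := y); clear; lia.
  by move: ab; clear; lia.
- have gapa := between_gap xa xb xDa xDb; have gap := between_gap_pair xa xb xDa xDb.
  rewrite (D'out x) //; case: ys => ->; rewrite ?D'a ?D'b ?D'Da ?D'Db.
  + by move: gapa; rewrite /between; clear; lia.
  + by move: ab; clear; lia.
  + by move: gap; rewrite /between; clear; lia.
  by move: gap; rewrite /between; clear; lia.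
by rewrite (D'out x) // (D'out y) // => /is_tl_nested/andP[_ /ltnW].
Qed.

Lemma is_tl_rewire : is_tl [ffun p => D' p].
Proof.
apply/and3P; split; apply/forallP => x; rewrite ?ffunE.
- by rewrite rewireK.
- by apply: rewire_neq => //; exact: tl_pair_neq.
by apply/forallP => y; rewrite !ffunE; have := @rewire_nested x y; lia.
Qed.

Definition rewire_diagram : tl_diagram t n := TLDiagram is_tl_rewire.

Lemma rewire_diagramE p : rewire_diagram p = D' p.
Proof. by rewrite ffunE. Qed.

End RewireDiagram.

(** * The overlay of two diagrams, its through lines and its loops *)

Section StackGraph.
Variables t n : nat.
Implicit Types (D : tl_diagram t n) (p : bpoint t n).

Definition mirror p : spoint t n t := match p with inl i => inr i | inr k => inl (inr k) end.

(** Extending the pairing by fixed points to the whole stack turns the overlay into a graph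
    generated by two total involutions, the setting of the surgery lemmas; fixed points do not
    affect connectivity. *)
Definition low_step D (u : spoint t n t) : spoint t n t :=
  match u with inl p => inl (D p) | inr j => inr j end.

Definition up_step D (u : spoint t n t) : spoint t n t :=
  match u with
  | inl (inl i) => u
  | inl (inr k) => mirror (D (inr k))
  | inr j => mirror (D (inl j))
  end.

Lemma up_step_mirror D p : up_step D (mirror p) = mirror (D p).
Proof. by case: p. Qed.

Lemma low_stepK D : involutive (low_step D).
Proof. by case=> //= p; rewrite tl_pairK. Qed.

Lemma up_stepK D : involutive (up_step D).
Proof. by case=> [[i|k]|j] //=; rewrite up_step_mirror tl_pairK. Qed.

Definition overlay D1 D2 : rel (spoint t n t) := two_step (up_step D1) (low_step D2).

Lemma overlay_sym D1 D2 : connect_sym (overlay D1 D2).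
Proof. exact: two_step_sym (@up_stepK D1) (@low_stepK D2). Qed.

Lemma connect_overlay D1 D2 :
  connect (stack_arc (tl_reflect D1) D2) =2 connect (overlay D1 D2).
Proof.
move=> u v; apply/idP/idP; apply: connect_sub => {}u {}v.
  case/orP => /existsP[x /andP[/eqP-> /eqP->]].
    by rewrite connect1 // /overlay /two_step eqxx orbT.
  rewrite connect1 // /overlay /two_step; apply/orP; left; rewrite ffunE.
  by case: x => x /=; case: (D1 _).
case/orP => /eqP->.
  case: u => [[i|k]|j]; rewrite /= ?connect0 // connect1 //; apply/orP; right; apply/existsP.
    by exists (inl k); rewrite eqxx ffunE /=; case: (D1 _).
  by exists (inr j); rewrite eqxx ffunE /=; case: (D1 _).
case: u => [p|j]; rewrite /= ?connect0 // connect1 //; apply/orP; left; apply/existsP.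
by exists p; rewrite !eqxx.
Qed.

Definition outer (x : bpoint t t) : spoint t n t := of_outer n x.

Definition overlay_ok D1 D2 : bool :=
  [forall x : bpoint t t, connect (overlay D1 D2) (outer x) (outer (tl_id t x))].

Definition overlay_loops D1 D2 : nat :=
  n_comp (overlay D1 D2) (off_boundary outer (overlay D1 D2)).

Lemma stack_coef_overlay (K : fieldType) (d : K) D1 D2 :
  stack_coef (tl_reflect D1) D2 d (tl_id t) =
  (if overlay_ok D1 D2 then d ^+ overlay_loops D1 D2 else 0)%R.
Proof.
rewrite /stack_coef /stacks_to; under eq_forallb do rewrite connect_overlay.
congr (if _ then GRing.exp d _ else _).
rewrite /stack_loops (eq_n_comp (connect_overlay D1 D2)); apply: eq_n_comp_r => u.
by rewrite !inE; apply: eq_forallb => x; rewrite connect_overlay.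
Qed.

Lemma low_step_rewire D a b D' : (forall p, D' p = rewire D a b p) ->
  low_step D' =1 rewire (low_step D) (inl a) (inl b).
Proof.
have inlE (p q : bpoint t n) : (inl p == inl q :> spoint t n t) = (p == q) by [].
move=> E [p|j] //=; rewrite E /rewire /= !inlE.
by case: (p == a); case: (p == b); case: (p == D a); case: (p == D b).
Qed.

Definition is_top p : bool := if p is inr _ then true else false.

Lemma is_topE p : is_top p = (t <= bpos p).
Proof. by rewrite leqNgt bpos_bottom; case: p. Qed.

Lemma outer_neq x p : is_top p -> outer x != inl p.
Proof. by case: x => i; case: p. Qed.

Section RewireStack.
Variables (D1 D2 D2' : tl_diagram t n) (a b : bpoint t n).
Hypotheses (ta : is_top a) (tb : is_top b) (D1a : D1 a = b).
Hypotheses (D2a : D2 a != b) (D2'E : forall p, D2' p = rewire D2 a b p).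

Let ab : a != b. Proof. by rewrite -D1a eq_sym tl_pair_neq. Qed.

Let up_a : up_step D1 (inl a) = inl b.
Proof. by move: ta tb D1a; case: a b => // i [] // j _ _ /= ->. Qed.

Let inlE (p q : bpoint t n) : (inl p == inl q :> spoint t n t) = (p == q). Proof. by []. Qed.

Let overlayE : overlay D1 D2' =2
  two_step (up_step D1) (rewire (low_step D2) (inl a) (inl b)).
Proof. by move=> u v; rewrite /overlay /two_step (low_step_rewire D2'E). Qed.

Lemma overlay_ok_rewire : overlay_ok D1 D2 = overlay_ok D1 D2'.
Proof.
apply: eq_forallb => x; rewrite (eq_connect overlayE).
apply: (connect_rewire_out (@up_stepK D1) (@low_stepK D2) up_a);
  rewrite ?inlE ?tl_pair_neq ?outer_neq //.
Qed.

Lemma overlay_loops_rewire : overlay_loops D1 D2' = (overlay_loops D1 D2).+1.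
Proof.
have := @rewire_n_comp _ _ _ _ _ (@up_stepK D1) (@low_stepK D2) up_a.
rewrite !inlE => /(_ ab (tl_pair_neq D2 a) D2a (tl_pair_neq D2 b) _ outer).
move=> /(_ (fun x => outer_neq x ta) (fun x => outer_neq x tb)) E.
rewrite /overlay_loops -E (eq_n_comp (eq_connect overlayE)); apply: eq_n_comp_r => u.
by rewrite !inE; apply: eq_forallb => x; rewrite (eq_connect overlayE).
Qed.

End RewireStack.

(** The arc [a]-[b] of [D1] connects two bottom points of [D2] to each other, and this component
    reaches no point of the upper line. *)
Lemma overlay_bad D1 D2 a b : is_top a -> is_top b -> D1 a = b ->
  ~~ is_top (D2 a) -> ~~ is_top (D2 b) -> overlay_ok D1 D2 = false.
Proof.
case: a => // ja _; case: b => // jb _ D1a.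
case Ea: (D2 (inr ja)) => [i|//] _; case Eb: (D2 (inr jb)) => [i'|//] _.
have D1b : D1 (inr jb) = inr ja by rewrite -D1a tl_pairK.
have Eia : D2 (inl i) = inr ja by rewrite -Ea tl_pairK.
have Eib : D2 (inl i') = inr jb by rewrite -Eb tl_pairK.
pose C := [pred u : spoint t n t | (u == inl (inl i)) || (u == inl (inr ja))
                                || (u == inl (inr jb)) || (u == inl (inl i'))].
have clC : closed (overlay D1 D2) C.
  apply: (intro_closed (overlay_sym D1 D2)) => u v uv.
  rewrite !inE => /orP[/orP[/orP[]|]|] /eqP uE; move: uv; rewrite uE;
    case/orP => /eqP -> /=; rewrite ?D1a ?D1b ?Ea ?Eb ?Eia ?Eib ?eqxx ?orbT //.
apply/negP => /forallP/(_ (inl i))/(closed_connect clC).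
by rewrite ffunE /outer /= !inE /= eqxx.
Qed.

Lemma overlay_ok_self D : Defs.monic D -> overlay_ok D D.
Proof.
move=> /forallP mD.
have H i : connect (overlay D D) (inl (inl i)) (inr i).
  have := mD i; case E: (D (inl i)) => [//|k] _.
  apply: (connect_trans (y := inl (inr k))); apply: connect1; apply/orP.
    by right; rewrite /= E.
  by left; rewrite /= -E tl_pairK.
apply/forallP => -[i|i]; rewrite ffunE /=; first exact: H.
by rewrite overlay_sym H.
Qed.

Lemma overlay_self_component D k k' v : D (inr k) = inr k' ->
  connect (overlay D D) (inl (inr k)) v -> (v == inl (inr k)) || (v == inl (inr k')).
Proof.
move=> E; have E' : D (inr k') = inr k by rewrite -E tl_pairK.
pose C := [pred v : spoint t n t | (v == inl (inr k)) || (v == inl (inr k'))].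
have clC : closed (overlay D D) C.
  apply: (intro_closed (overlay_sym D D)) => u w uw.
  by rewrite !inE => /orP[] /eqP uE; move: uw; rewrite uE;
    case/orP => /eqP -> /=; rewrite ?E ?E' ?eqxx ?orbT.
by move/(closed_connect clC); rewrite !inE eqxx /= => <-.
Qed.

Definition arc_start D (k : 'I_n) := bpos (inr k : bpoint t n) < bpos (D (inr k)).

Lemma arc_start_top D k : arc_start D k -> exists k', D (inr k) = inr k'.
Proof.
rewrite /arc_start; case E: (D (inr k)) => [i|k'] H; last by exists k'.
by move: H => /=; have := ltn_ord i; lia.
Qed.

(** Each arc between top points closes up with its mirror image to a loop on two points; its start
    serves as representative. *)
Lemma overlay_loops_self D : overlay_loops D D = #|[pred k | arc_start D k]|.
Proof.
pose T' := {k : 'I_n | arc_start D k}.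
pose h (k : T') : spoint t n t := inl (inr (val k)).
pose e' : rel T' := fun _ _ => false.
have ce' (x y : T') : connect e' x y = (x == y).
  apply/idP/eqP => [/connectP[[|z p] //= _ ->] //|->]; exact: connect0.
have symE' : connect_sym e' by move=> x y; rewrite !ce' eq_sym.
have clA : closed (overlay D D) (off_boundary outer (overlay D D)).
  exact: (off_boundary_closed _ (@up_stepK D) (@low_stepK D)).
rewrite /overlay_loops (adjunction_n_comp h (overlay_sym D D) symE' clA).
  rewrite /n_comp_mem -(card_sig (arc_start D)); apply: eq_card => k; rewrite !inE.
  have -> : roots e' k by have := connect_root e' k; rewrite ce' /roots eq_sym.
  rewrite /=; apply/forallP => x; apply/negP.
  have [k' E] := arc_start_top (valP k).
  by move/(overlay_self_component E); case: x.
split=> [u uA|x' y' xA].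
  apply: sigW; case: u uA => [[i|k]|j]; rewrite inE => /forallP H.
  - by have := H (inl i); rewrite connect0.
  - case E: (D (inr k)) => [i|k'].
      have := H (inl i); rewrite connect1 //; apply/orP; right.
      by rewrite /= E.
    have [sk|sk] := boolP (arc_start D k); first by exists (Sub k sk); rewrite connect0.
    have E' : D (inr k') = inr k by rewrite -E tl_pairK.
    have sk' : arc_start D k'.
      move: sk; rewrite /arc_start E E' -leqNgt leq_eqVlt => /orP[/eqP/bpos_inj e|//].
      by have := tl_pair_neq D (inr k); rewrite E e eqxx.
    exists (Sub k' sk'); rewrite connect1 //; apply/orP; right; by rewrite /= E.
  - by have := H (inr j); rewrite connect0.
rewrite ce'; apply/eqP/idP => [->|]; first exact: connect0.
have [k' E] := arc_start_top (valP x').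
move/(overlay_self_component E) => /orP[/eqP[] /val_inj //|/eqP[e]].
have sx : arc_start D (val x') := valP x'.
have sy : arc_start D (val y') := valP y'.
have e2 : inr (val y') = D (inr (val x')) :> bpoint t n by rewrite E -e.
by move: sx sy; rewrite /arc_start e2 tl_pairK; case: ltngtP.
Qed.

Lemma card_arc_start D : #|[pred k | arc_start D k]| = count id (word_of D).
Proof.
rewrite count_map -sum1_count -sum1_card.
have -> : iota t n = index_iota t (t + n) by rewrite /index_iota addKn.
rewrite -[X in index_iota X _]add0n big_addn addKn big_mkord.
rewrite [RHS](reindex_inj rev_ord_inj) /=; apply: eq_bigl => k.
rewrite inE /arc_start -pair_posE /=.
by rewrite addnC.
Qed.

End StackGraph.

Local Open Scope ring_scope.

(** * State vectors and the Gram matrix *)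

Section StateVectors.
Variables (K : fieldType) (s : K).
Hypothesis s0 : s != 0.

(* Row [w] of [statev n t z] is the vector of [V^(x)n] obtained from the diagram of
   the word [w] when its through lines carry the colours [z], the rightmost first;
   [true] stands for [e1] and [false] for [e2]. A popped point must have the colour
   on top of the stack [z], a pushed point stacks the opposite colour. *)
Definition pop_rows n (f : forall t, seq bool -> 'M[K]_(nwords n t, ncolorings n)) t z
    : 'M[K]_(npop n t, ncolorings n) :=
  match t with 0%N => 0 | t'.+1 => f t' z end.

Fixpoint statev n : forall t, seq bool -> 'M[K]_(nwords n t, ncolorings n) :=
  match n with
  | 0%N => fun t z => const_mx 1
  | n'.+1 => fun t z =>
      col_mx (row_mx (if head true z then pop_rows (@statev n') t (behead z) else 0)
                     (if head true z then 0 else pop_rows (@statev n') t (behead z)))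
             (row_mx (s^-1 *: statev n' t.+1 (false :: z))
                     (s *: statev n' t.+1 (true :: z)))
  end.

(** The value for which the cup is annihilated by both operators below: the conditions are
    [s^-1 + rho^-1 * s = 0] and [rho * s^-1 + s = 0]. When [s ^ 2 = - q] it is [q]. *)
Definition rho : K := - s ^+ 2.

Lemma rho0 : rho != 0.
Proof. by rewrite oppr_eq0 expf_neq0. Qed.

(* The lowering operator of quantum sl2 on [V^(x)n]; its transpose is a raising
   operator. *)
Fixpoint lowerm n : 'M[K]_(ncolorings n) :=
  if n is n'.+1 then block_mx (rho *: lowerm n') 1%:M 0 (rho^-1 *: lowerm n') else 0.

(* The lowering and raising operators applied to the basis vector [z] of [V^(x)t],
   as lists of pairs (coefficient, basis vector). Diagrams intertwine them with
   the operators on [V^(x)n], see [statev_lowerm] and [statev_raisem]. *)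
Fixpoint lowers (z : seq bool) : seq (K * seq bool) :=
  if z is c :: z' then
    let r := [seq ((if c then rho else rho^-1) * p.1, c :: p.2) | p <- lowers z'] in
    if c then (1, false :: z') :: r else r
  else [::].

Fixpoint raises (z : seq bool) : seq (K * seq bool) :=
  if z is c :: z' then
    let r := [seq ((if c then rho else rho^-1) * p.1, c :: p.2) | p <- raises z'] in
    if c then r else (1, true :: z') :: r
  else [::].

Definition lincomb n t (l : seq (K * seq bool)) : 'M[K]_(nwords n t, ncolorings n) :=
  \sum_(p <- l) p.1 *: statev n t p.2.

Definition lincombp n t (l : seq (K * seq bool)) : 'M[K]_(npop n t, ncolorings n) :=
  \sum_(p <- l) p.1 *: pop_rows (@statev n) t p.2.

Definition pref (c : bool) (a : K) (l : seq (K * seq bool)) :=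
  [seq (a * p.1, c :: p.2) | p <- l].

Lemma lincomb_cons n t p l : lincomb n t (p :: l) = p.1 *: statev n t p.2 + lincomb n t l.
Proof. by rewrite /lincomb big_cons. Qed.

Lemma lincombp_cons n t p l :
  lincombp n t (p :: l) = p.1 *: pop_rows (@statev n) t p.2 + lincombp n t l.
Proof. by rewrite /lincombp big_cons. Qed.

Lemma lincomb_pref_scale n t c a l :
  lincomb n t (pref c a l) = a *: lincomb n t (pref c 1 l).
Proof.
rewrite /lincomb !big_map scaler_sumr; apply: eq_bigr => p _ /=.
by rewrite mul1r scalerA.
Qed.

Lemma statevS n t z : statev n.+1 t z =
      col_mx (row_mx (if head true z then pop_rows (@statev n) t (behead z) else 0)
                     (if head true z then 0 else pop_rows (@statev n) t (behead z)))
             (row_mx (s^-1 *: statev n t.+1 (false :: z))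
                     (s *: statev n t.+1 (true :: z))).
Proof. by []. Qed.

Lemma lincombS n t c l : lincomb n.+1 t (pref c 1 l) =
  col_mx (row_mx (if c then lincombp n t l else 0) (if c then 0 else lincombp n t l))
         (row_mx (s^-1 *: lincomb n t.+1 (pref false 1 (pref c 1 l)))
                 (s *: lincomb n t.+1 (pref true 1 (pref c 1 l)))).
Proof.
elim: l => [|[a z] l IH].
  rewrite /lincomb /lincombp /pref /= !big_nil !scaler0 !if_same.
  by rewrite -[LHS]vsubmxK -[usubmx _]hsubmxK -[dsubmx _]hsubmxK !linear0.
rewrite /= lincomb_cons IH statevS /= mul1r.
rewrite !scale_col_mx !scale_row_mx !add_col_mx !add_row_mx.
rewrite lincombp_cons !lincomb_cons /= !mul1r !scalerDr !scalerA ![a * _]mulrC.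
by congr (col_mx (row_mx _ _) _); case: c {IH}; rewrite ?scaler0 ?addr0 ?add0r.
Qed.

Lemma lincombS' n t c a l : lincomb n.+1 t (pref c a l) =
  col_mx (row_mx (if c then a *: lincombp n t l else 0)
                 (if c then 0 else a *: lincombp n t l))
         (row_mx (s^-1 *: lincomb n t.+1 (pref false 1 (pref c a l)))
                 (s *: lincomb n t.+1 (pref true 1 (pref c a l)))).
Proof.
rewrite lincomb_pref_scale lincombS scale_col_mx !scale_row_mx.
have E d : a *: lincomb n t.+1 (pref d 1 (pref c 1 l)) =
           lincomb n t.+1 (pref d 1 (pref c a l)).
  by rewrite /lincomb !big_map scaler_sumr; apply: eq_bigr => p _ /=;
    rewrite !mul1r scalerA.
rewrite ![a *: (_ *: lincomb _ _ _)]scalerA ![a * _]mulrC -!scalerA !E.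
by congr (col_mx (row_mx _ _) _); case: c {E}; rewrite ?scaler0.
Qed.

Lemma flatmx_eq m n (A B : 'M[K]_(m, n)) : m = 0%N -> A = B.
Proof. by move=> m0; move: A B; rewrite m0 => A B; rewrite [A]flatmx0 [B]flatmx0. Qed.

Lemma lowers_cons c z :
  lowers (c :: z) = (if c then [:: (1, false :: z)] else [::])
    ++ pref c (if c then rho else rho^-1) (lowers z).
Proof. by case: c. Qed.

Lemma raises_cons c z :
  raises (c :: z) = (if c then [::] else [:: (1, true :: z)])
    ++ pref c (if c then rho else rho^-1) (raises z).
Proof. by case: c. Qed.

Lemma lincomb_cat n t l1 l2 : lincomb n t (l1 ++ l2) = lincomb n t l1 + lincomb n t l2.
Proof. by rewrite /lincomb big_cat. Qed.

Lemma lincomb1 n t a z : lincomb n t [:: (a, z)] = a *: statev n t z.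
Proof. by rewrite /lincomb big_seq1. Qed.

Lemma lincomb_nil n t : lincomb n t [::] = 0.
Proof. by rewrite /lincomb big_nil. Qed.

(** The operator kills cups, so its contributions at a pushed pair cancel and only its action on the
    through lines remains. *)
Lemma statev_lowerm n t z : size z = t ->
  statev n t z *m lowerm n = lincomb n t (lowers z).
Proof.
elim: n t z => [|n IH] t z zt.
  rewrite /= mulmx0; case: z zt => [|c z] /= <-; first by rewrite lincomb_nil.
  exact: flatmx_eq.
have pushE : row_mx (s^-1 *: statev n t.+1 (false :: z)) (s *: statev n t.+1 (true :: z))
    *m lowerm n.+1 =
  row_mx (s^-1 *: lincomb n t.+1 (pref false 1 (lowers z)))
         (s *: lincomb n t.+1 (pref true 1 (lowers z))).
  rewrite /= mul_row_block mulmx0 addr0 mulmx1 -!scalemxAr -!scalemxAl.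
  rewrite !IH /= ?zt // lincomb_cons -/(pref true rho _) -/(pref false rho^-1 _) /=.
  rewrite lincomb_pref_scale [lincomb _ _ (pref true _ _)]lincomb_pref_scale.
  congr row_mx.
    by rewrite !scalerA mulrAC divff ?mul1r // rho0.
  rewrite scale1r !scalerDr !scalerA addrA -scalerDl.
  rewrite -mulrA [X in _ + X *: _]mulrCA mulVf ?rho0 // mulr1.
  suff -> : s^-1 + rho^-1 * s = 0 by rewrite scale0r add0r.
  by rewrite /rho invrN expr2 invfM mulNr -mulrA mulVf // mulr1 subrr.
case: z zt pushE => [|c z] zt pushE; rewrite statevS mul_col_mx pushE.
  rewrite !lincomb_nil !scaler0 row_mx0 -[RHS]col_mx0; congr col_mx.
  by apply: flatmx_eq; rewrite -zt.
case: t zt {pushE} => // t [zt].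
rewrite lowers_cons lincomb_cat lincombS'.
have lincombpE l : lincombp n t.+1 l = lincomb n t l by [].
rewrite lincombpE -IH // {lincombpE}.
case: c.
  rewrite lincomb1 scale1r statevS add_col_mx !add_row_mx /=; congr col_mx.
    by rewrite mul_row_block !mul0mx !addr0 mulmx1 -scalemxAr add0r.
  by rewrite !lincomb_cons /= mulr1 !scale1r !scalerDr.
rewrite lincomb_nil add0r; congr col_mx.
by rewrite /= mul_row_block !mul0mx !add0r mulmx0 -scalemxAr.
Qed.

Lemma statev_raisem n t z : size z = t ->
  statev n t z *m (lowerm n)^T = lincomb n t (raises z).
Proof.
elim: n t z => [|n IH] t z zt.
  rewrite /= trmx0 mulmx0; case: z zt => [|c z] /= <-; first by rewrite lincomb_nil.
  exact: flatmx_eq.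
have pushE : row_mx (s^-1 *: statev n t.+1 (false :: z)) (s *: statev n t.+1 (true :: z))
    *m (lowerm n.+1)^T =
  row_mx (s^-1 *: lincomb n t.+1 (pref false 1 (raises z)))
         (s *: lincomb n t.+1 (pref true 1 (raises z))).
  rewrite /= tr_block_mx trmx1 trmx0 !linearZ /=.
  rewrite mul_row_block mulmx0 add0r mulmx1 -!scalemxAr -!scalemxAl.
  rewrite !IH /= ?zt // lincomb_cons -/(pref true rho _) -/(pref false rho^-1 _) /=.
  rewrite lincomb_pref_scale [lincomb _ _ (pref true _ _)]lincomb_pref_scale.
  congr row_mx; last first.
    by rewrite !scalerA mulrAC mulVf ?mul1r // rho0.
  rewrite scale1r !scalerDr !scalerA addrAC -scalerDl.
  suff [-> ->] : rho * s^-1 + s = 0 /\ rho * s^-1 * rho^-1 = s^-1.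
    by rewrite scale0r add0r.
  split; last by rewrite mulrAC divff ?mul1r // rho0.
  by rewrite /rho mulNr expr2 mulfK // addNr.
case: z zt pushE => [|c z] zt pushE; rewrite statevS mul_col_mx pushE.
  rewrite !lincomb_nil !scaler0 row_mx0 -[RHS]col_mx0; congr col_mx.
  by apply: flatmx_eq; rewrite -zt.
case: t zt {pushE} => // t [zt].
rewrite raises_cons lincomb_cat lincombS'.
have lincombpE l : lincombp n t.+1 l = lincomb n t l by [].
rewrite lincombpE -IH // {lincombpE}.
case: c; last first.
  rewrite lincomb1 scale1r statevS add_col_mx !add_row_mx /=; congr col_mx.
    rewrite tr_block_mx trmx1 trmx0 !linearZ /=.
    by rewrite mul_row_block !mul0mx !addr0 !add0r mulmx1 -scalemxAr.
  by rewrite !lincomb_cons /= mulr1 !scale1r !scalerDr.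
rewrite lincomb_nil add0r; congr col_mx.
rewrite /= tr_block_mx trmx1 trmx0 !linearZ /=.
by rewrite mul_row_block !mul0mx !addr0 mulmx0 -scalemxAr.
Qed.

Definition allup t := nseq t true.

Lemma raises_allup t : raises (allup t) = [::].
Proof. by elim: t => //= t ->. Qed.

Definition onedown i j := nseq i true ++ false :: nseq j true.

Lemma lowers_allup t :
  lowers (allup t) = [seq (rho ^+ i, onedown i (t - i.+1)) | i <- iota 0 t].
Proof.
elim: t => // t IH; rewrite [LHS]/= IH [RHS]/= subn1 /=; congr cons.
rewrite -[1%N]/(1 + 0)%N iotaDl -!map_comp; apply: eq_map => i /=.
by rewrite exprS subSS.
Qed.

Lemma raises_onedown i j :
  raises (onedown i j) = [:: (rho ^+ i, allup (i + j.+1))].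
Proof.
elim: i => [|i IH] /=; first by rewrite -/(allup j) raises_allup.
by rewrite -/(onedown i j) IH /= exprS.
Qed.

(* The quantum integer [m] up to a power of [s]. *)
Definition qint m : K := \sum_(i < m) rho ^+ (2 * i).

(** All-up states are highest weight vectors, on which lowering and then raising is a scalar. The
    [i]-th through line contributes [rho ^+ i] once on the way down and once on the way up. *)
Lemma lower_raise n t :
  statev n t (allup t) *m lowerm n *m (lowerm n)^T = qint t *: statev n t (allup t).
Proof.
rewrite statev_lowerm ?size_nseq // /lincomb lowers_allup big_map.
rewrite mulmx_suml /qint scaler_suml -(big_mkord xpredT (fun i => rho ^+ (2 * i) *: _)).
rewrite /index_iota subn0 big_seq [RHS]big_seq; apply: eq_bigr => i.
rewrite mem_iota /= => it; rewrite -scalemxAl statev_raisem; last first.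
  by rewrite size_cat /= !size_nseq; lia.
rewrite raises_onedown lincomb1 scalerA -exprD addnn -mul2n.
by rewrite -[(i + _)%N]/(i + (t - i.+1).+1)%N; congr (_ *: statev _ _ (allup _)); lia.
Qed.

(* The raising operator is the transpose of the lowering one and kills the all-up
   states. *)
Lemma lower_orth n t t' :
  statev n t (allup t) *m lowerm n *m (statev n t' (allup t'))^T = 0.
Proof.
rewrite -mulmxA -[lowerm n]trmxK -trmx_mul statev_raisem ?size_nseq //.
by rewrite raises_allup lincomb_nil trmx0 mulmx0.
Qed.

(* Joining the through lines [k] and [k+1], counted from the right, turns the letter that closes
   the first of them into a push. *)
Lemma cup_insert n r k : (k <= r)%N ->
  exists N : 'M[K]_(nwords n r.+2, nwords n r), forall z1 z2,
    size z1 = k -> (size z1 + size z2)%N = r ->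
    N *m statev n r (z1 ++ z2) =
      s^-1 *: statev n r.+2 (z1 ++ true :: false :: z2)
      + s *: statev n r.+2 (z1 ++ false :: true :: z2).
Proof.
elim: n r k => [|n IH] r k kr; first by exists 0 => z1 z2 _ _; apply: flatmx_eq.
have [N2 HN2] := IH r.+1 k.+1 kr.
have push z1 z2 : size z1 = k -> (size z1 + size z2)%N = r ->
    N2 *m row_mx (s^-1 *: statev n r.+1 (false :: z1 ++ z2))
                 (s *: statev n r.+1 (true :: z1 ++ z2)) =
    s^-1 *: row_mx (s^-1 *: statev n r.+3 (false :: z1 ++ true :: false :: z2))
                 (s *: statev n r.+3 (true :: z1 ++ true :: false :: z2))
  + s *: row_mx (s^-1 *: statev n r.+3 (false :: z1 ++ false :: true :: z2))
                 (s *: statev n r.+3 (true :: z1 ++ false :: true :: z2)).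
  move=> z1k zr; rewrite mul_mx_row -!scalemxAr.
  rewrite (HN2 (false :: z1) z2) ?(HN2 (true :: z1) z2) /= ?z1k ?addSn -?zr ?z1k //.
  rewrite !scale_row_mx add_row_mx !scalerDr !scalerA.
  by rewrite ![s * s^-1]mulrC.
case: k kr push {HN2} => [|k] kr push.
  exists (block_mx 0 1%:M 0 N2) => -[|//] z2 _ zr.
  rewrite !cat0s !statevS /= mul_block_col !mul0mx !add0r mul1mx.
  rewrite !scale_col_mx add_col_mx (push [::]) //; congr (col_mx _ _).
  by rewrite !scale_row_mx add_row_mx !scaler0 addr0 add0r.
case: r N2 kr push => // r N2 kr push.
have [N1 HN1] := IH r k kr.
exists (block_mx N1 0 0 N2) => -[//|c z1] z2 z1k zr.
rewrite !statevS mul_block_col !mul0mx addr0 add0r.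
rewrite !scale_col_mx add_col_mx push //; congr (col_mx _ _).
case: z1k => z1k; move: zr => /=; rewrite addSn => -[zr].
rewrite /= mul_mx_row !scale_row_mx add_row_mx.
by case: c => /=; rewrite HN1 // mulmx0 !scaler0 addr0.
Qed.

Definition bottom_pop n t := pop_rows (statev n) t (allup t.-1).

Lemma statev_allup n t : statev n.+1 t (allup t) =
  col_mx (row_mx (bottom_pop n t) 0)
         (row_mx (s^-1 *: statev n t.+1 (false :: allup t))
                 (s *: statev n t.+1 (allup t.+1))).
Proof. by rewrite statevS; case: t. Qed.

(** By [cup_insert], exchanging neighbours [true, false] for [false, true] costs the factor
    [- s ^ 2 = rho] modulo states with two through lines fewer; [i] exchanges bring the [false] to
    the front. *)
Lemma onedown_sub n r i : (i <= r.+1)%N ->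
  (statev n r.+2 (onedown i (r.+1 - i)) - rho ^+ i *: statev n r.+2 (false :: allup r.+1)
    <= statev n r (allup r))%MS.
Proof.
elim: i => [|i IH] ir; first by rewrite expr0 scale1r subn0 subrr sub0mx.
have [N HN] := @cup_insert n r i ir.
have := HN (allup i) (allup (r - i)); rewrite !size_nseq => /(_ erefl (@subnKC i r ir)).
rewrite -[allup i ++ allup _]nseqD (@subnKC i r ir).
have -> : allup i ++ [:: true, false & allup (r - i)] = onedown i.+1 (r.+1 - i.+1).
  by rewrite /onedown subSS -[i.+1]addn1 nseqD -catA.
have -> : allup i ++ [:: false, true & allup (r - i)] = onedown i (r.+1 - i).
  by rewrite /onedown subSn.
move=> E.
have {E}-> : statev n r.+2 (onedown i.+1 (r.+1 - i.+1)) =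
    rho *: statev n r.+2 (onedown i (r.+1 - i)) + s *: (N *m statev n r (allup r)).
  rewrite E scalerDr !scalerA divff // scale1r addrCA -scalerDl.
  by rewrite /rho -expr2 addNr scale0r addr0.
rewrite addrAC exprS -scalerA -scalerBr addmx_sub ?scalemx_sub ?IH ?submxMl //.
exact: ltnW.
Qed.

(** Lowering the all-up state gives [rho ^+ i] times the state with its [i]-th line down, and by
    [onedown_sub] this is [rho ^+ (2 * i)] times the state with the first line down, modulo the pop
    block. Summing over [i] yields the quantum integer. *)
Lemma lowered_sub n t :
  exists M, qint t.+1 *: statev n t.+1 (false :: allup t) =
    statev n t.+1 (allup t.+1) *m lowerm n + M *m bottom_pop n t.
Proof.
rewrite statev_lowerm ?size_nseq // lowers_allup.
case: t => [|r].
  exists 0; rewrite mul0mx addr0 lincomb1 expr0 /qint big_ord_recl big_ord0 addr0.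
  by rewrite expr0.
suff /submxP[M HM] : (qint r.+2 *: statev n r.+2 (false :: allup r.+1) -
   lincomb n r.+2 [seq (rho ^+ i, onedown i (r.+2 - i.+1)) | i <- iota 0 r.+2]
   <= bottom_pop n r.+1)%MS.
  by exists M; rewrite -HM addrC subrK.
rewrite -opprB eqmx_opp /lincomb big_map /qint scaler_suml.
rewrite -(big_mkord xpredT (fun i => rho ^+ (2 * i) *: _)) /index_iota subn0 -sumrB.
rewrite big_seq; apply: summx_sub => i; rewrite mem_iota /= => ir.
by rewrite mul2n -addnn exprD -scalerA -scalerBr scalemx_sub // subSS onedown_sub.
Qed.

Definition gram n t : 'M[K]_(nwords n t) :=
  statev n t (allup t) *m (statev n t (allup t))^T.

Definition gram_pop n t : 'M[K]_(npop n t) := bottom_pop n t *m (bottom_pop n t)^T.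

Lemma qintS m : qint m.+1 = 1 + s ^+ 4 * qint m.
Proof.
rewrite /qint big_ord_recl expr0 mulr_sumr; congr (1 + _); apply: eq_bigr => i _.
have -> : s ^+ 4 = rho ^+ 2 by rewrite /rho sqrrN -exprM.
by rewrite lift0 mulnS exprD.
Qed.

Lemma bottom_orth n t :
  statev n t.+1 (allup t.+1) *m lowerm n *m (bottom_pop n t)^T = 0.
Proof.
by case: t => [|t]; [rewrite /bottom_pop /= trmx0 mulmx0 | exact: lower_orth].
Qed.

(** [L] removes the component along the pop block that [lowered_sub] exhibits. The off-diagonal
    blocks then vanish by [bottom_orth], and by [lower_raise] the lower block has the coefficient
    [s^-2 / [t+1] + s^2], which [qintS] simplifies. *)
Lemma gram_step n t : qint t.+1 != 0 ->
  exists2 L : 'M[K]_(nwords n.+1 t), \det L = 1 &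
    L *m gram n.+1 t *m L^T = block_mx (gram_pop n t) 0 0
      ((s ^- 2 * qint t.+2 / qint t.+1) *: gram n t.+1).
Proof.
move=> q0; have [M HM] := lowered_sub n t.
set q := qint t.+1 in q0 HM *.
set R := statev n t.+1 (allup t.+1) in HM *.
set P := bottom_pop n t in HM *.
have orth : R *m lowerm n *m P^T = 0 := bottom_orth n t.
pose L : 'M[K]_(nwords n.+1 t) := block_mx 1%:M 0 (- (s^-1 * q^-1) *: M) 1%:M.
exists L; first by rewrite det_lblock !det1 mulr1.
have LV : L *m statev n.+1 t (allup t) =
  col_mx (row_mx P 0) (row_mx ((s^-1 * q^-1) *: (R *m lowerm n)) (s *: R)).
  rewrite statev_allup mul_block_col !mul1mx mul0mx addr0; congr col_mx.
  rewrite mul_mx_row add_row_mx mulmx0 add0r; congr row_mx.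
  have -> : statev n t.+1 (false :: allup t) = q^-1 *: (R *m lowerm n + M *m P).
    by rewrite -HM scalerA mulVf // scale1r.
  by rewrite !scalerDr !scalerA -scalemxAl scaleNr addrCA addNr addr0.
rewrite /gram mulmxA -mulmxA -trmx_mul LV tr_col_mx !tr_row_mx trmx0 mul_col_mx.
rewrite !mul_mx_row !mul_row_col !linearZ /= -!scalemxAl mul0mx addr0.
have orth' : P *m (R *m lowerm n)^T = 0 by apply: trmx_inj; rewrite trmx_mul trmxK orth trmx0.
rewrite orth orth' !mulmx0 !mul0mx !scaler0 !addr0 /block_mx; congr (col_mx _ (row_mx _ _)).
rewrite trmx_mul mulmxA lower_raise -/R -/q -scalemxAl !scalerA -scalerDl; congr (_ *: _).
by rewrite qintS -/q; field; rewrite q0 s0.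
Qed.

Lemma det_gram_step n t : qint t.+1 != 0 ->
  \det (gram n.+1 t) = \det (gram_pop n t) *
    ((s ^- 2 * qint t.+2 / qint t.+1) ^+ nwords n t.+1 * \det (gram n t.+1)).
Proof.
move=> q0; have [L detL E] := gram_step n q0.
have := congr1 determinant E; rewrite !det_mulmx det_tr detL mul1r mulr1 => ->.
by rewrite det_ublock detZ.
Qed.

Lemma rank_gram_step n t : qint t.+1 != 0 -> qint t.+2 != 0 ->
  \rank (gram n.+1 t) = (\rank (gram_pop n t) + \rank (gram n t.+1))%N.
Proof.
move=> q0 q1; have [L detL E] := gram_step n q0.
have uL : L \in unitmx by rewrite unitmxE detL unitr1.
have := congr1 mxrank E; rewrite mxrankMfree ?row_free_unit ?unitmx_tr //.
rewrite eqmxMfull ?row_full_unit // => ->; rewrite rank_diag_block_mx.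
by rewrite eqmx_scale // !mulf_neq0 ?invr_eq0 ?expf_neq0.
Qed.

Lemma rank_gram_wall n t : qint t.+1 != 0 -> qint t.+2 = 0 ->
  \rank (gram n.+1 t) = \rank (gram_pop n t).
Proof.
move=> q0 q1; have [L detL E] := gram_step n q0.
have uL : L \in unitmx by rewrite unitmxE detL unitr1.
have := congr1 mxrank E; rewrite mxrankMfree ?row_free_unit ?unitmx_tr //.
rewrite eqmxMfull ?row_full_unit // => ->; rewrite rank_diag_block_mx.
by rewrite q1 mulr0 mul0r scale0r mxrank0 addn0.
Qed.

End StateVectors.

(** * Entries of state vectors as weights of pushdown runs *)

Section Automaton.
Variables (K : fieldType) (s : K).

Definition kap (c : bool) : K := if c then s^-1 else s.

Fixpoint autw (w x z : seq bool) : K :=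
  match w, x with
  | [::], [::] => (z == [::])%:R
  | true :: w', c :: x' => kap c * autw w' x' (~~ c :: z)
  | false :: w', c :: x' => if z is d :: z' then (c == d)%:R * autw w' x' z' else 0
  | _, _ => 0
  end.

Lemma statevE n t z (i : 'I_(nwords n t)) (c : 'I_(ncolorings n)) : size z = t ->
  statev s n t z i c = autw (nth [::] (words n t) i) (nth [::] (colorings n) c) z.
Proof.
elim: n t z i c => [|n IH] t z i c zt.
  case: z zt i c => [|d z] <- /=; last by case.
  by move=> i c; rewrite mxE !ord1.
rewrite statevS [words _ _]/= [colorings _]/= !nth_cat.
have -> : size (if t is t'.+1 then map (cons false) (words n t') else [::]) = npop n t.
  by case: (t) => //= t'; rewrite size_map size_words.
rewrite size_map size_colorings.
case: (split_ordP i) => i' ->; case: (split_ordP c) => c' -> /=;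
  rewrite ?ltn_ord ?(ltnNge (_ + _)) ?leq_addr /= ?addKn ?col_mxEu ?col_mxEd
    ?row_mxEl ?row_mxEr.
- case: t zt {i c} i' => [|t] zt i'; first by case: i'.
  case: z zt => // d z [zt] /=; rewrite !(nth_map [::]) ?size_words ?size_colorings ?ltn_ord //=.
  by case: d; rewrite ?mxE ?mul0r // mul1r IH.
- case: t zt {i c} i' => [|t] zt i'; first by case: i'.
  case: z zt => // d z [zt] /=; rewrite !(nth_map [::]) ?size_words ?size_colorings ?ltn_ord //=.
  by case: d; rewrite ?mxE ?mul0r // mul1r IH.
- rewrite !(nth_map [::]) ?size_words ?size_colorings ?ltn_ord //=.
  by rewrite mxE IH //= zt.
rewrite !(nth_map [::]) ?size_words ?size_colorings ?ltn_ord //=.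
by rewrite mxE IH //= zt.
Qed.

Lemma gramE n t (i j : 'I_(nwords n t)) : gram s n t i j =
  \sum_(x <- colorings n) autw (nth [::] (words n t) i) x (nseq t true)
                        * autw (nth [::] (words n t) j) x (nseq t true).
Proof.
rewrite /gram mxE (big_nth [::]) size_colorings big_mkord; apply: eq_bigr => c _.
by rewrite [in X in _ * X]mxE !statevE ?size_nseq.
Qed.

(** The stack holds the complementary colours of the open points, so the test at a pop compares the
    two ends of one arc. This makes the weight a product of local factors. *)
Lemma aut_run N m (y : nat -> bool) k : matching N m -> (k <= N)%N ->
  autw (letters m k (N - k)) [seq y j | j <- iota k (N - k)]
       [seq ~~ y p | p <- open_points m k] =
  \prod_(k <= j < N) (if (j < m j)%N then kap (y j) else (y j != y (m j))%:R).
Proof.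
move=> Hm kN; have [l lE] : exists l, l = (N - k)%N by exists (N - k)%N.
rewrite -lE; elim: l k kN lE => [|l IH] k kN lE.
  have -> : k = N by lia.
  by rewrite (open_last Hm) big_geq.
have kN' : (k < N)%N by lia.
rewrite big_ltn // -IH //; last lia.
rewrite /=; have [km|mk] := boolP (k < m k)%N; first by rewrite (open_push Hm).
rewrite (open_pop Hm) //=; last by have := matching_neq Hm kN'; lia.
by congr (_%:R * _); case: (y k); case: (y (m k)).
Qed.

(** At a pop the colour is forced by the stack; at a push both colours are allowed and contribute
    [s^-2] and [s^2]. *)
Lemma autw_sq w z : s != 0 -> valid_word (size z) w ->
  \sum_(x <- colorings (size w)) autw w x z ^+ 2 = (s ^+ 2 + s ^- 2) ^+ count id w.
Proof.
move=> s0; elim: w z => [|c w IH] z /=; first by rewrite big_seq1 => /nilP->; rewrite expr1n.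
rewrite big_cat !big_map /=; case: c => /= [vw|].
  rewrite add1n exprS mulrDl addrC; congr (_ + _).
    by rewrite -(IH (true :: z) vw) mulr_sumr; apply: eq_bigr => x _; rewrite exprMn.
  by rewrite -(IH (false :: z) vw) mulr_sumr; apply: eq_bigr => x _; rewrite exprMn exprVn.
case: z => // d z /= vw; rewrite add0n -(IH z vw) -big_split /=; apply: eq_bigr => x _.
by case: d; rewrite !(mul0r, mul1r) expr0n /= ?addr0 ?add0r.
Qed.

End Automaton.

(** * The bilinear form as a state sum *)

Section Weights.
Variables (K : fieldType) (s : K) (t n : nat).
Implicit Types (p : bpoint t n) (D : tl_diagram t n) (x : {ffun 'I_n -> bool}).

(* A bottom point carries the colour opposite to the one of the through line
   it emits, so that every arc joins two points of different colours. *)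
Definition bcolor x p : bool := if p is inr j then x j else false.

Definition bkap x p : K := if p is inr j then kap s (x j) else 1.

Definition arc_end x p q : K :=
  if (bpos p < bpos q)%N then bkap x p else (bcolor x p != bcolor x q)%:R.

Definition diagram_weight D x : K := \prod_p arc_end x p (D p).

Definition color_at x k :=
  if [pick p : bpoint t n | bpos p == k] is Some p then bcolor x p else false.

Lemma color_atE x p : color_at x (bpos p) = bcolor x p.
Proof.
rewrite /color_at; case: pickP => [q /eqP/(@bpos_inj t n)->//|/(_ p)]; by rewrite eqxx.
Qed.

Definition color_word x := [seq color_at x k | k <- iota t n].

Lemma prod_positions (F : nat -> K) :
  \prod_p F (bpos (p : bpoint t n)) = \prod_(0 <= k < t + n) F k.
Proof.
rewrite big_sumType /= (big_cat_nat (n := t)) ?leq_addr //= big_mkord; congr (_ * _).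
rewrite (reindex_inj rev_ord_inj) /=.
rewrite -[X in _ = \big[_/_]_(X <= _ < _) _]add0n big_addn addKn big_mkord.
by apply: eq_bigr => j _; congr F; have := ltn_ord j; lia.
Qed.

Lemma diagram_weightE D x : Defs.monic D ->
  diagram_weight D x = autw s (word_of D) (color_word x) (nseq t true).
Proof.
move=> mD; have Hm := pair_pos_matching D.
pose F k : K := if (k < t)%N then 1 else
  if (k < pair_pos D k)%N then kap s (color_at x k)
  else (color_at x k != color_at x (pair_pos D k))%:R.
have -> : diagram_weight D x = \prod_p F (bpos (p : bpoint t n)).
  apply: eq_bigr => p _; rewrite /arc_end /F pair_posE !color_atE bpos_bottom.
  case: p => [i|j] //=; case: ifPn => // h.
  have := monicE mD (ltn_ord i); rewrite -[nat_of_ord i]/(bpos (inl i : bpoint t n)) pair_posE.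
  by have := ltn_ord i; move: h => /=; lia.
rewrite prod_positions (big_cat_nat (n := t)) ?leq_addr //=.
rewrite big_nat big1 ?mul1r => [|k]; last by rewrite /F /= => ->.
have := aut_run s (color_at x) Hm (leq_addr n t).
rewrite addKn open_points_monic // -/(word_of D) -/(color_word x).
have -> : [seq ~~ color_at x k | k <- rev (iota 0 t)] = nseq t true.
  rewrite -[t in RHS](size_iota 0) -size_rev -(size_map (fun k => ~~ color_at x k)).
  apply/all_pred1P/allP => _ /mapP[k + ->]; rewrite mem_rev mem_iota /= => kt.
  by rewrite -[k]/(bpos (inl (Ordinal kt) : bpoint t n)) color_atE.
move=> ->; rewrite big_nat [RHS]big_nat; apply: eq_bigr => k /andP[tk _].
by rewrite /F ltnNge tk.
Qed.

Lemma sum_color_word (F : seq bool -> K) :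
  \sum_x F (color_word x) = \sum_(w <- colorings n) F w.
Proof.
pose S := [seq color_word x | x <- enum {: {ffun 'I_n -> bool}}].
have inj : injective color_word.
  move=> x y E; apply/ffunP => j.
  have := bpos_lt (inr j : bpoint t n); rewrite -!/(bcolor _ (inr j : bpoint t n)) -!color_atE.
  have : (t <= bpos (inr j : bpoint t n))%N by rewrite leqNgt bpos_bottom.
  move: (bpos _) => k tk kN.
  have := congr1 (fun w => nth false w (k - t)) E.
  by rewrite /color_word !(nth_map 0%N) ?size_iota ?nth_iota ?subnKC //; lia.
have uS : uniq S by rewrite map_inj_uniq // enum_uniq.
have sub : {subset S <= colorings n}.
  have memc m w : size w = m -> w \in colorings m.
    elim: m w => [|m IH] [|c w] //= [wm]; rewrite mem_cat; apply/orP.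
    by case: c; [left|right]; rewrite map_f // IH.
  by move=> _ /mapP[x _ ->]; apply: memc; rewrite size_map size_iota.
have szE : (size (colorings n) <= size S)%N.
  rewrite size_colorings size_map -cardE card_ffun card_bool card_ord.
  by elim: (n) => //= m IH; rewrite expnS; lia.
have [_ SE] := uniq_min_size uS sub szE.
rewrite (perm_big S); first by rewrite big_map big_enum.
apply: (uniq_perm _ uS); first exact: leq_size_uniq uS sub szE.
by move=> w; rewrite SE.
Qed.

End Weights.

(** * Behaviour of the state sum under rewiring *)

Section WeightRewire.
Variables (K : fieldType) (s : K) (t n : nat).
Hypothesis s0 : s != 0.
Implicit Types (x : {ffun 'I_n -> bool}) (p q : bpoint t n).

Definition arcw x p q : K := arc_end s x p q * arc_end s x q p.

Lemma arcwC x p q : arcw x p q = arcw x q p.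
Proof. exact: mulrC. Qed.

Lemma arcwE x p q : (bpos p < bpos q)%N ->
  arcw x p q = bkap s x p * (bcolor x p != bcolor x q)%:R.
Proof. by move=> pq; rewrite /arcw /arc_end pq ltnNge (ltnW pq) [bcolor x p == _]eq_sym. Qed.

Lemma bkap_top x p : is_top p -> bkap s x p = kap s (bcolor x p).
Proof. by case: p. Qed.

Lemma kapN c : kap s c * kap s (~~ c) = 1.
Proof. by case: c; rewrite /= ?mulVf ?divff. Qed.

Lemma weight_split2 (E : tl_diagram t n) a b x : E a = b ->
  diagram_weight s E x =
  arcw x a b * \prod_(p | (p != a) && (p != b)) arc_end s x p (E p).
Proof.
move=> Ea; have Eb : E b = a by rewrite -Ea tl_pairK.
have ba : b != a by rewrite -Ea tl_pair_neq.
by rewrite /diagram_weight (bigD1 a) //= (bigD1 b) //= Ea Eb mulrA.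
Qed.

Variables (D1 D2 D2' : tl_diagram t n) (a b : bpoint t n).
Hypotheses (ta : is_top a) (tb : is_top b) (D1a : D1 a = b).
Hypotheses (ab : (bpos a < bpos b)%N) (D2a : D2 a != b).
Hypothesis D2'E : forall p, D2' p = rewire D2 a b p.
Hypothesis inner :
  forall y, (bpos a < bpos y < bpos b)%N -> (bpos a < bpos (D2 y) < bpos b)%N.

Let a' := D2 a.
Let b' := D2 b.
Let DK := tl_pairK D2.
Let a_neq_b : a != b. Proof. by apply/eqP => e; move: ab; rewrite e ltnn. Qed.
Let aa' : a' != a. Proof. exact: tl_pair_neq. Qed.
Let bb' : b' != b. Proof. exact: tl_pair_neq. Qed.
Let b'a : b' != a. Proof. by rewrite -(inj_eq (can_inj DK)) /b' DK eq_sym. Qed.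
Let b'a' : b' != a'. Proof. by rewrite (inj_eq (can_inj DK)) eq_sym. Qed.

Definition other_arcs x : K :=
  \prod_(p | ((p != a) && (p != b)) && (p != a') && (p != b')) arc_end s x p (D2 p).

Lemma weight_split4 x : diagram_weight s D2 x = arcw x a a' * arcw x b b' * other_arcs x.
Proof.
rewrite /diagram_weight (bigD1 a) //= (bigD1 b) /=; last by rewrite eq_sym.
rewrite (bigD1 a') /=; last by rewrite aa'.
rewrite (bigD1 b') /=; last by rewrite b'a bb'.
by rewrite -/a' -/b' {2}/a' {2}/b' !DK -/(other_arcs x) /arcw; ring.
Qed.

Lemma weight_split4' x : diagram_weight s D2' x = arcw x a b * arcw x a' b' * other_arcs x.
Proof.
have D'a : D2' a = b by rewrite D2'E /rewire eqxx.
have D'b : D2' b = a by rewrite D2'E /rewire eqxx eq_sym (negPf a_neq_b).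
have D'a' : D2' a' = b' by rewrite D2'E /rewire (negPf aa') (negPf D2a) eqxx.
have D'b' : D2' b' = a' by rewrite -D'a' tl_pairK.
rewrite /diagram_weight (bigD1 a) //= (bigD1 b) /=; last by rewrite eq_sym.
rewrite (bigD1 a') /=; last by rewrite aa'.
rewrite (bigD1 b') /=; last by rewrite b'a bb'.
rewrite D'a D'b D'a' D'b' /arcw.
have -> : \prod_(p | ((p != a) && (p != b)) && (p != a') && (p != b'))
    arc_end s x p (D2' p) = other_arcs x.
  apply: eq_bigr => p /andP[/andP[/andP[pa pb] pa'] pb'].
  by rewrite D2'E /rewire (negPf pa) (negPf pb) (negPf pa') (negPf pb').
ring.
Qed.

(** The fourth arrangement, [b'] before [a] and [a'] after [b], would make the arcs of [a] and [b]
    cross. *)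
Lemma pair_order : [\/ (bpos a' < bpos a)%N /\ (bpos b < bpos b')%N,
   (bpos b < bpos b')%N /\ (bpos b' < bpos a')%N |
   (bpos b' < bpos a')%N /\ (bpos a' < bpos a)%N].
Proof.
have [oa ob] := outer_pair ab D2a inner.
have nest := @is_tl_nested t n D2.
have h1 := nest b' a; have h2 := nest a' b'; have h3 := nest b a'.
have h4 := bpos_neq b'a'.
rewrite /b' /a' !DK in h1 h2 h3 h4 *.
have [p1|p1] := ltnP (bpos (D2 a)) (bpos a); have [p2|p2] := ltnP (bpos b) (bpos (D2 b)).
- by constructor 1.
- by constructor 3; split=> //; move: h2 p1 p2 ab ob h4; clear; lia.
- by constructor 2; split=> //; move: h3 p1 p2 ab oa h4; clear; lia.
- by exfalso; move: h1 p1 p2 ab oa ob; clear; lia.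
Qed.

Hypothesis not_both : is_top a' || is_top b'.

(* The straightening relation of a cup against a cap, in the three planar positions
   allowed by [pair_order]. *)
Lemma zigzag x : bcolor x b = ~~ bcolor x a -> bcolor x a' = ~~ bcolor x a ->
  kap s (bcolor x a) * arcw x a a' * arcw x b b' = arcw x a' b'.
Proof.
move=> cb ca'; have [cb'|cb'] := eqVneq (bcolor x b') (bcolor x a); last first.
  have {}cb' : bcolor x b' = ~~ bcolor x a by move: cb'; do 2 case: (bcolor _ _).
  have zero p q : bcolor x p = bcolor x q -> p != q -> arcw x p q = 0.
    move=> c /bpos_neq /eqP; rewrite neq_ltn => /orP[] h; last rewrite arcwC;
      by rewrite arcwE // c eqxx mulr0.
  rewrite (zero b b') ?cb ?cb' // 1?eq_sym // (zero a' b') ?ca' ?cb' // 1?eq_sym //.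
  by rewrite mulr0.
have ab_top := bkap_top x; have k1 := kapN (bcolor x a).
have nn c : (~~ c != c)%:R = 1 :> K by case: c.
have nn' c : (c != ~~ c)%:R = 1 :> K by case: c.
case: pair_order => -[o1 o2].
- rewrite arcwC !arcwE // ?(ltn_trans o1 (ltn_trans ab o2)) //.
  rewrite ca' cb cb' !nn !mulr1 (ab_top b) // cb mulrAC k1 mul1r //.
- have tb' : is_top b' by move: tb; rewrite !is_topE => h; exact: leq_trans h (ltnW o1).
  rewrite [arcw _ a' b']arcwC !arcwE // ?(ltn_trans ab (ltn_trans o1 o2)) //.
  rewrite ca' cb cb' !nn !nn' !mulr1 (ab_top a) // (ab_top b) // cb.
  by rewrite (ab_top b') // cb' -mulrA k1 mulr1.
have ta' : is_top a' by case/orP: not_both => //;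
  rewrite !is_topE => h; exact: leq_trans h (ltnW o1).
rewrite [arcw _ a _]arcwC [arcw _ b _]arcwC [arcw _ a' b']arcwC.
rewrite !arcwE // ?(ltn_trans o1 (ltn_trans o2 ab)) //.
by rewrite ca' cb cb' !nn !nn' !mulr1 (ab_top a') // ca' k1 mul1r.
Qed.

(* Summing over the orbits of this involution produces the loop value. *)
Definition flip_arc x : {ffun 'I_n -> bool} :=
  [ffun j => if (inr j == a) || (inr j == b) then ~~ x j else x j].

Lemma flipK : involutive flip_arc.
Proof. by move=> x; apply/ffunP => j; rewrite !ffunE; case: (_ || _); rewrite ?negbK. Qed.

Lemma bcolor_flip x p : p != a -> p != b -> bcolor (flip_arc x) p = bcolor x p.
Proof. by case: p => //= j /negPf ja /negPf jb; rewrite ffunE ja jb. Qed.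

Lemma bcolor_flip_a x : bcolor (flip_arc x) a = ~~ bcolor x a.
Proof. by rewrite /flip_arc; case: a ta => // j _ /=; rewrite ffunE eqxx. Qed.

Lemma bcolor_flip_b x : bcolor (flip_arc x) b = ~~ bcolor x b.
Proof. by rewrite /flip_arc; case: b tb => // j _ /=; rewrite ffunE eqxx orbT. Qed.

Lemma arc_end_flip x p q : p != a -> p != b -> q != a -> q != b ->
  arc_end s (flip_arc x) p q = arc_end s x p q.
Proof.
move=> pa pb qa qb; rewrite /arc_end !bcolor_flip //; case: ifP => // _.
by case: p pa pb => //= j /negPf ja /negPf jb; rewrite ffunE ja jb.
Qed.

Definition pair_weight (E : tl_diagram t n) x : K := diagram_weight s D1 x * diagram_weight s E x.

Lemma pair_weight_flip x : bcolor x a != bcolor x a' ->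
  pair_weight D2' x + pair_weight D2' (flip_arc x) = (s ^+ 2 + s ^- 2) * pair_weight D2 x.
Proof.
move=> caa'; rewrite /pair_weight !(weight_split2 _ D1a) !weight_split4' weight_split4.
have -> : other_arcs (flip_arc x) = other_arcs x.
  apply: eq_bigr => p /andP[/andP[/andP[pa pb] pa'] pb']; apply: arc_end_flip => //.
    by rewrite -(inj_eq (can_inj DK)) DK.
  by rewrite -(inj_eq (can_inj DK)) DK.
have -> : \prod_(p | (p != a) && (p != b)) arc_end s (flip_arc x) p (D1 p) =
          \prod_(p | (p != a) && (p != b)) arc_end s x p (D1 p).
  apply: eq_bigr => p /andP[pa pb]; apply: arc_end_flip => //.
    by rewrite -(inj_eq (can_inj (tl_pairK D1))) tl_pairK D1a.
  by rewrite -D1a (inj_eq (can_inj (tl_pairK D1))).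
have -> : arcw (flip_arc x) a' b' = arcw x a' b' by rewrite /arcw !arc_end_flip.
rewrite !(arcwE _ ab) !bkap_top // bcolor_flip_a bcolor_flip_b.
have [cab|cab] := eqVneq (bcolor x a) (bcolor x b).
  by rewrite cab eqxx !mulr0 !mul0r !mulr0 addr0.
have cb : bcolor x b = ~~ bcolor x a by move: cab; do 2 case: (bcolor _ _).
have ca' : bcolor x a' = ~~ bcolor x a by move: caa'; do 2 case: (bcolor _ _).
have neg : (~~ bcolor x a != ~~ bcolor x b) by rewrite (inj_eq negb_inj).
rewrite neg !mulr1 -(zigzag cb ca').
set R1 := \prod_(p | _) _; move: (arcw x a a') (arcw x b b') (other_arcs x) => A B R2.
have d2 : kap s (bcolor x a) ^+ 2 + kap s (~~ bcolor x a) ^+ 2 = s ^+ 2 + s ^- 2.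
  by case: (bcolor x a) => /=; rewrite exprVn // addrC.
rewrite -d2; ring.
Qed.

Lemma pair_weight_eq0 x : bcolor x a = bcolor x a' -> pair_weight D2 x = 0.
Proof.
move=> c; rewrite /pair_weight weight_split4.
suff -> : arcw x a a' = 0 by rewrite !mul0r mulr0.
have /bpos_neq/eqP := aa'; rewrite neq_ltn => /orP[] h; first rewrite arcwC;
  by rewrite arcwE // c eqxx mulr0.
Qed.

(** [flip_arc] exchanges the colourings in which [a] and [a'] differ with those in which they agree;
    the latter contribute nothing to the sum for [D2]. *)
Lemma sum_pair_weight_rewire :
  \sum_x pair_weight D2' x = (s ^+ 2 + s ^- 2) * \sum_x pair_weight D2 x.
Proof.
rewrite (bigID (fun x => bcolor x a != bcolor x a')) /=.
rewrite [X in _ + X](reindex_inj (can_inj flipK)) /=.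
under [X in _ + X]eq_bigl => x.
  rewrite bcolor_flip_a bcolor_flip //.
  have -> : ~~ (~~ bcolor x a != bcolor x a') = (bcolor x a != bcolor x a').
    by do 2 case: (bcolor _ _).
  over.
rewrite -big_split /= [in RHS](bigID (fun x => bcolor x a != bcolor x a')) /=.
rewrite [X in _ * (_ + X)]big1 ?addr0 => [|x]; last first.
  by rewrite negbK => /eqP; exact: pair_weight_eq0.
by rewrite mulr_sumr; apply: eq_bigr => x; exact: pair_weight_flip.
Qed.

End WeightRewire.

Section StackCoef.
Variables (K : fieldType) (s : K) (t n : nat).
Hypothesis s0 : s != 0.
Hypothesis d0 : s ^+ 2 + s ^- 2 != 0.
Implicit Types (D : tl_diagram t n) (p : bpoint t n).

Lemma monic_top D p : Defs.monic D -> ~~ is_top p -> is_top (D p).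
Proof. by case: p => // i /forallP/(_ i); case: (D _). Qed.

Lemma self_pairing D : Defs.monic D ->
  stack_coef (tl_reflect D) D (s ^+ 2 + s ^- 2) (tl_id t) =
  \sum_x diagram_weight s D x * diagram_weight s D x.
Proof.
move=> mD; rewrite stack_coef_overlay overlay_ok_self // overlay_loops_self card_arc_start.
under eq_bigr do rewrite !diagram_weightE //.
rewrite (@sum_color_word K t n (fun w => autw s (word_of D) w (nseq t true)
  * autw s (word_of D) w (nseq t true))).
have := word_of_words mD; rewrite mem_words => /andP[/eqP wn vw].
by rewrite -(autw_sq s0 (z := nseq t true)) ?size_nseq // wn; apply: eq_bigr.
Qed.

Definition through D : {set bpoint t n} := [set D (inl i) | i : 'I_t].

Lemma card_through D : #|through D| = t.
Proof.
by rewrite card_imset ?card_ord // => i j /(can_inj (@tl_pairK t n D)) [].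
Qed.

Lemma mem_through D p : (p \in through D) = ~~ is_top (D p).
Proof.
apply/imsetP/idP => [[i _ ->]|]; first by rewrite tl_pairK.
by case E: (D p) => [i|//] _; exists i => //; rewrite -E tl_pairK.
Qed.

(** Exactly [t] top points of a monic diagram end through lines. If [D2] has all top arcs of [D1],
    counting forces the same through points, hence the same opening letters. *)
Lemma eq_diagrams D1 D2 : Defs.monic D1 -> Defs.monic D2 ->
  (forall p, is_top p -> is_top (D1 p) -> D2 p = D1 p) -> D1 = D2.
Proof.
move=> m1 m2 E.
have sub : through D2 \subset through D1.
  apply/subsetP => p; rewrite !mem_through; apply: contra => t1.
  have [tp|bp] := boolP (is_top p); first by rewrite E.
  exact: monic_top.
have eqT : through D2 = through D1 by apply/eqP; rewrite eqEcard sub !card_through leqnn.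
apply: diagram_letters_inj => p; have [tp|bp] := boolP (is_top p); last first.
  have := monic_top m1 bp; have := monic_top m2 bp.
  by move: bp; rewrite !is_topE; lia.
have [t1|b1] := boolP (is_top (D1 p)); first by rewrite E.
have b2 : ~~ is_top (D2 p) by rewrite -mem_through eqT mem_through.
by move: tp b1 b2; rewrite !is_topE; lia.
Qed.

(* Rewire [D2] along an innermost arc of [D1] that [D2] lacks: both sides get
   multiplied by the loop value, and [D2] comes closer to [D1]. *)
Lemma stack_coefE D1 D2 : Defs.monic D1 -> Defs.monic D2 ->
  stack_coef (tl_reflect D1) D2 (s ^+ 2 + s ^- 2) (tl_id t) =
  \sum_x diagram_weight s D1 x * diagram_weight s D2 x.
Proof.
move=> m1; have [k] := ubnP #|[pred p | D1 p != D2 p]|.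
elim: k D2 => // k IH D2; rewrite ltnS => leD m2.
pose bad p := [&& is_top p, is_top (D1 p), (bpos p < bpos (D1 p))%N & D2 p != D1 p].
have [a0 bad0|good] := pickP bad; last first.
  suff <- : D1 = D2 by exact: self_pairing.
  apply: eq_diagrams => // p tp t1; apply/eqP; have := good p; have := good (D1 p).
  rewrite /bad tp t1 tl_pairK tp /=.
  have := tl_pair_neq D1 p; have [lt|lt|/bpos_inj e] := ltngtP (bpos p) (bpos (D1 p)).
  - by move=> _ _ /= /negbFE.
  - move=> _ /= /negbFE/eqP e _; by rewrite -{1}e tl_pairK.
  - by rewrite -e eqxx.
(* Below a shortest missing arc every arc of [D1] is shorter, hence present in [D2]. So [D2] pairs
   the gap with itself, as rewiring requires. *)
pose a := [arg min_(p < a0 | bad p) (bpos (D1 p) - bpos p)%N].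
have [bada mina] : bad a /\ forall p, bad p -> (bpos (D1 a) - bpos a <= bpos (D1 p) - bpos p)%N.
  by rewrite /a; case: arg_minnP.
have /and4P[ta tb ab D2a] := bada; move: mina; set b := D1 a in tb ab D2a * => mina.
have D1b : D1 b = a by rewrite tl_pairK.
have inner y : (bpos a < bpos y < bpos b)%N -> (bpos a < bpos (D2 y) < bpos b)%N.
  move=> yab; have y1 : (bpos a < bpos (D1 y) < bpos b)%N := is_tl_nested yab.
  have ty : is_top y.
    by move: yab ta => /andP[lt _]; rewrite !is_topE => /leq_trans; apply; exact: ltnW.
  have ty1 : is_top (D1 y).
    by move: y1 ta => /andP[lt _]; rewrite !is_topE => /leq_trans; apply; exact: ltnW.
  suff -> : D2 y = D1 y by [].
  have neq := tl_pair_neq D1 y.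
  have [lt|lt|/bpos_inj e] := ltngtP (bpos y) (bpos (D1 y)); last by rewrite -e eqxx in neq.
    apply/eqP/negbNE/negP => ne; have := mina y; rewrite /bad ty ty1 lt ne.
    by move=> /(_ isT); move: yab y1 lt; clear; lia.
  have e : D2 (D1 y) = y.
    apply/eqP/negbNE/negP => ne; have := mina (D1 y).
    rewrite /bad tl_pairK ty ty1 lt ne => /(_ isT).
    by move: yab y1 lt; clear; lia.
  by rewrite -{1}e tl_pairK.
(* If [D2] sends both ends to the bottom, the form is 0 by [overlay_bad]. The state sum is 0 too:
   both ends would need the colour [true], while the arc of [D1] demands different colours. *)
have [nb|] := boolP (is_top (D2 a) || is_top (D2 b)); last first.
  rewrite negb_or => /andP[na nb].
  rewrite stack_coef_overlay (overlay_bad ta tb erefl na nb) big1 // => x _.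
  rewrite (weight_split2 _ _ (erefl : D1 a = b)) (arcwE _ _ ab).
  have [c|c] := eqVneq (bcolor x a) (bcolor x b); first by rewrite mulr0 !mul0r.
  have [p pab xp] : exists2 p, (p == a) || (p == b) & bcolor x p = false.
    case ca: (bcolor x a); last by exists a; rewrite ?eqxx.
    by exists b; rewrite ?eqxx ?orbT //; move: c; rewrite ca; case: (bcolor x b).
  have zero : arcw s x p (D2 p) = 0.
    have [tp np] : is_top p /\ ~~ is_top (D2 p) by case/orP: pab => /eqP->.
    rewrite arcwC arcwE; last first.
      by move: tp np; rewrite !is_topE -ltnNge => tp np; exact: leq_trans np tp.
    by rewrite xp; case: (D2 p) np => //= i _; rewrite mulr0.
  by rewrite (weight_split2 _ _ (erefl : D2 p = D2 p)) zero mul0r mulr0.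
pose D2' := rewire_diagram ab D2a inner.
have D2'E p : D2' p = rewire D2 a b p := rewire_diagramE ab D2a inner p.
have topneq (p q : bpoint t n) : is_top p -> ~~ is_top q -> (q == p) = false.
  by move=> tp; apply: contraNF => /eqP->.
have m2' : Defs.monic D2'.
  apply/forallP => i; suff : is_top (D2' (inl i)) by case: (D2' _).
  rewrite D2'E /rewire (topneq a) // (topneq b) //.
  case: eqP => [e|_]; first by case/orP: nb; rewrite // -e.
  case: eqP => [e|_]; first by case/orP: nb; rewrite // -e.
  exact: monic_top.
have lt : (#|[pred p | D1 p != D2' p]| < k)%N.
  apply: leq_trans leD; apply: proper_card; apply/properP; split.
    apply/subsetP => p; rewrite !inE D2'E /rewire.
    case: (eqVneq p a) => [->|pa]; first by rewrite eqxx.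
    case: (eqVneq p b) => [->|pb]; first by rewrite D1b eqxx.
    case: (eqVneq p (D2 a)) => [e _|_].
      by rewrite e tl_pairK -e -D1b (inj_eq (can_inj (tl_pairK D1))).
    case: (eqVneq p (D2 b)) => [e _|//].
    by rewrite e tl_pairK -e (inj_eq (can_inj (tl_pairK D1))).
  by exists a; rewrite !inE ?D2'E /rewire ?eqxx // eq_sym.
have := IH D2' lt m2'.
rewrite stack_coef_overlay -(overlay_ok_rewire ta tb erefl D2a D2'E).
rewrite (overlay_loops_rewire ta tb erefl D2a D2'E).
rewrite -[\sum_x _]/(\sum_x pair_weight s D1 D2' x).
rewrite (sum_pair_weight_rewire s0 ta tb erefl ab D2a D2'E inner nb) stack_coef_overlay.
(* The extra loop is cancelled here, which is why the loop value must be nonzero. *)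
move=> E; apply: (mulfI d0); rewrite -E; case: ifP; rewrite ?mulr0 // => _.
by rewrite [RHS]exprS.
Qed.

End StackCoef.

(** * Gram determinants on the walls *)

Section Chebyshev.
Variable K : fieldType.

(* The quantum integers as polynomials in the loop value. *)
Fixpoint chebU m : {poly K} :=
  match m with
  | 0%N => 0
  | 1%N => 1
  | (m'.+1 as m1).+1 => 'X * chebU m1 - chebU m'
  end.

Lemma chebUSS m : chebU m.+2 = 'X * chebU m.+1 - chebU m.
Proof. by []. Qed.

(** [qint] is normalised to start with 1, so the symmetric quantum integer [[m]], which is the value
    of [chebU m], is [s ^ (2 - 2m)] times it. *)
Lemma chebU_qint (s : K) m : s != 0 ->
  (chebU m).[s ^+ 2 + s ^- 2] * s ^+ (2 * m) = s ^+ 2 * qint s m.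
Proof.
move=> s0; elim/ltn_ind: m => -[|[|m]] IH.
- by rewrite horner0 mul0r /qint big_ord0 mulr0.
- by rewrite /= -polyC1 hornerC mul1r /qint big_ord_recl big_ord0 /= muln0 expr0 addr0 mulr1.
have H1 := IH m.+1 (ltnSn _); have H0 := IH m (ltnW (ltnSn _)).
rewrite chebUSS hornerD hornerN hornerM hornerX mulrBl.
have Ex k : s ^+ (2 * k.+1) = s ^+ 2 * s ^+ (2 * k) by rewrite mulnS exprD.
rewrite !Ex in H0 H1 *; rewrite !qintS // in H0 H1 *.
set u1 := (chebU m.+1).[_] in H1 *; set u0 := (chebU m).[_] in H0 *.
set x := s ^+ (2 * m) in H0 H1 *; set Q := qint s m in H0 H1 *.
have E1 : u1 * x = 1 + s ^+ 4 * Q.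
  by apply: (mulfI (expf_neq0 2 s0)); rewrite -H1 mulrCA.
transitivity (s ^+ 4 * (s ^+ 2 + s ^- 2) * (u1 * x) - s ^+ 4 * (u0 * x)).
  by ring.
by rewrite E1 H0; field.
Qed.

Lemma chebU_root_qint (s : K) m : s != 0 ->
  ((chebU m).[s ^+ 2 + s ^- 2] == 0) = (qint s m == 0).
Proof.
move=> s0; have := chebU_qint m s0 => /(congr1 (eq_op^~ 0)).
by rewrite /= !mulf_eq0 !expf_eq0 (negPf s0) !andbF orbF.
Qed.

Lemma chebU_ratio (s : K) m : s != 0 ->
  s ^- 2 * qint s m.+1 / qint s m =
  (chebU m.+1).[s ^+ 2 + s ^- 2] / (chebU m).[s ^+ 2 + s ^- 2].
Proof.
move=> s0; have s20 := expf_neq0 2 s0.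
have E k : (chebU k).[s ^+ 2 + s ^- 2] = s ^+ 2 * qint s k / s ^+ (2 * k).
  by rewrite -(chebU_qint k s0) mulfK // expf_neq0.
rewrite !E mulnS exprD; have [->|q0] := eqVneq (qint s m) 0.
  by rewrite !mulr0 mul0r !invr0 !mulr0.
by field; rewrite q0 s0 expf_neq0.
Qed.

(* With [chebU_consecutive], this shows that the roots of [chebU] are simple. *)
Lemma deriv_chebU m :
  ('X ^+ 2 - 4%:R) * (chebU m.+1)^`() =
  m.+1%:R * ('X * chebU m.+1 - 2%:R * chebU m) - 'X * chebU m.+1.
Proof.
elim/ltn_ind: m => -[|[|m]] IH.
- by rewrite /= derivC; ring.
- rewrite /= mulr1 subr0 derivX; ring.
have H1 := IH m.+1 (ltnSn _); have H0 := IH m (ltnW (ltnSn _)).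
rewrite (chebUSS m.+1) derivB derivM derivX mul1r.
set A := _ ^+ 2 - _ in H0 H1 *.
transitivity (A * chebU m.+2 + 'X * (A * (chebU m.+2)^`()) - A * (chebU m.+1)^`()).
  by ring.
rewrite H0 H1 /A !(chebUSS m) -(@natr1 _ m.+2) -(@natr1 _ m.+1).
by ring.
Qed.

Lemma chebU_consecutive (x : K) m :
  (chebU m.+1).[x] = 0 -> (chebU m).[x] != 0.
Proof.
elim: m => [|m IH]; first by rewrite hornerE => /eqP; rewrite oner_eq0.
rewrite chebUSS !hornerE => E; apply/eqP => E1; move: E.
by rewrite E1 mulr0 add0r => /eqP; rewrite oppr_eq0; apply/negP/IH.
Qed.

Hypothesis K0 : [pchar K] =i pred0.

(** The classical limit [[m] = m]; in characteristic 0 it shows that [chebU m] is a nonzero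
    polynomial for [m > 0]. *)
Lemma chebU_at2 m : (chebU m).[2%:R] = m%:R.
Proof.
elim/ltn_ind: m => -[|[|m]] IH; first by rewrite horner0.
  by rewrite /= -polyC1 hornerC.
rewrite chebUSS hornerD hornerN hornerM hornerX !IH // -[in RHS]addn2 -[m.+1]addn1 !natrD; ring.
Qed.

Lemma chebU_neq0 m : (0 < m)%N -> chebU m != 0.
Proof.
move=> m0; apply/eqP => /(congr1 (horner^~ 2%:R)) /eqP.
rewrite chebU_at2 horner0.
by case: m m0 => // m _; rewrite (pcharf0P K).1.
Qed.

Lemma mup_chebU (x : K) m : (0 < m)%N -> mup x (chebU m) = ((chebU m).[x] == 0).
Proof.
case: m => // m _; case: eqP => E; last by rewrite mupNroot //; apply/rootP.
have U0 := chebU_neq0 (ltn0Sn m).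
apply/eqP; rewrite eqn_leq mup_leq // mup_geq // expr1 dvdp_XsubCl; apply/andP; split.
  apply/negP => /dvdpP[r Er].
  have dU : ((chebU m.+1)^`()).[x] = 0.
    rewrite Er expr2 mulrA derivM derivXsubC hornerD !hornerM hornerXsubC subrr.
    by rewrite !mulr0 mul0r addr0.
  have := congr1 (horner^~ x) (deriv_chebU m).
  rewrite /= hornerM dU mulr0 hornerD hornerN !hornerM hornerX E mulr0 subr0 -[m.+1%:R]polyC_natr.
  rewrite hornerC hornerD hornerN !hornerM hornerX E mulr0 sub0r -polyC_natr hornerC.
  move=> /esym/eqP; rewrite mulf_eq0 oppr_eq0 mulf_eq0.
  rewrite (negPf (chebU_consecutive E)) orbF.
  by rewrite !(pcharf0P K).1.
by apply/rootP.
Qed.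

End Chebyshev.

Lemma nwords_gt n t : (n < t)%N -> nwords n t = 0%N.
Proof.
elim: n t => [|n IH] [|t] //= nt.
by rewrite IH // IH //; lia.
Qed.

Lemma poly_vanish (K : idomainType) (p : {poly K}) : [pchar K] =i pred0 ->
  (forall x, p.[x] = 0) -> p = 0.
Proof.
move=> K0 p0; pose rs : seq K := [seq i%:R | i <- iota 0 (size p)].
apply: (@roots_geq_poly_eq0 _ _ rs).
- by apply/allP => x _; apply/rootP.
- rewrite map_inj_uniq ?iota_uniq // => i j /eqP.
  wlog: i j / (i <= j)%N => [H|ij].
    by case/orP: (leq_total i j) => ij; [|rewrite eq_sym => ?; apply/esym]; apply: H.
  rewrite eq_sym -subr_eq0 -natrB // (pcharf0P K).1 // => ji.
  by apply/eqP; rewrite eqn_leq ij -subn_eq0.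
- by rewrite size_map size_iota.
Qed.

Section WallDeterminant.
Variable K : numClosedFieldType.

Lemma exists_loop_root (d : K) : exists2 s, s != 0 & d = s ^+ 2 + s ^- 2.
Proof.
have [s Es] := @solve_monicpoly K 4
  (fun i => if i == 2%N then d else if i == 0%N then -1 else 0) isT.
rewrite !big_ord_recl big_ord0 /= /bump /= !mul0r !addr0 add0r mulN1r expr0 in Es.
have s0 : s != 0.
  apply/eqP => s0; move: Es; rewrite s0 !expr0n /= mulr0 addr0.
  by move/eqP; rewrite eq_sym oppr_eq0 oner_eq0.
exists s => //.
have : d * s ^+ 2 = s ^+ 4 + 1 by rewrite Es; ring.
move=> /(canRL (mulfK (expf_neq0 2 s0))) ->.
by field; rewrite ?s0.
Qed.

Variable PG : forall n t, 'M[{poly K}]_(nwords n t).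
Hypothesis PGE : forall s n t, s != 0 -> s ^+ 2 + s ^- 2 != 0 ->
  map_mx (horner_eval (s ^+ 2 + s ^- 2)) (PG n t) = gram s n t.

Definition pdet n t := \det (PG n t).
Definition pdet_pop n t := if t is t'.+1 then pdet n t' else 1.

Lemma pdetE s n t : s != 0 -> s ^+ 2 + s ^- 2 != 0 ->
  (pdet n t).[s ^+ 2 + s ^- 2] = \det (gram s n t).
Proof. by move=> s0 d0; rewrite -PGE // det_map_mx. Qed.

Lemma pdet_popE s n t : s != 0 -> s ^+ 2 + s ^- 2 != 0 ->
  (pdet_pop n t).[s ^+ 2 + s ^- 2] = \det (gram_pop s n t).
Proof.
move=> s0 d0; case: t => [|t]; last exact: pdetE.
by rewrite /pdet_pop -polyC1 hornerC det_mx00.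
Qed.

Let K0 := @Num.Theory.pchar_num K.

(** This is [det_gram_step] with denominators cleared; as an identity of polynomials it remains
    available at the zeros of [[t+1]]. *)
Lemma pdet_rec n t : let d := nwords n t.+1 in
  pdet n.+1 t * chebU K t.+1 ^+ d = pdet_pop n t * (chebU K t.+2 ^+ d * pdet n t.+1).
Proof.
move=> d; apply/eqP; rewrite -subr_eq0; apply/eqP.
(* The factor discards the points at which [det_gram_step] cannot be evaluated: loop value 0 and the
   zeros of [[t+1]]. *)
have : ('X * chebU K t.+1) != 0 by rewrite mulf_neq0 ?polyX_eq0 ?chebU_neq0.
move=> /mulIf; apply; rewrite mul0r; apply: poly_vanish => // x.
have [s s0 Ex] := exists_loop_root x.
rewrite !hornerM hornerX.
have [->|x0] := eqVneq x 0; first by rewrite mul0r mulr0.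
have [->|u0] := eqVneq (chebU K t.+1).[x] 0; first by rewrite !mulr0.
rewrite hornerD hornerN !hornerM !horner_exp.
have q0 : qint s t.+1 != 0 by rewrite -chebU_root_qint // -Ex.
have := det_gram_step s0 n q0; rewrite chebU_ratio // -Ex -/d => E.
rewrite Ex !pdetE ?pdet_popE -?Ex // E expr_div_n.
have ud : (chebU K t.+1).[x] ^+ d != 0 by rewrite expf_neq0.
by apply/eqP; rewrite mulf_eq0 subr_eq0; apply/orP; left; apply/eqP; field.
Qed.

Lemma pdet0 s t : s != 0 -> s ^+ 2 + s ^- 2 != 0 -> (pdet 0 t).[s ^+ 2 + s ^- 2] = 1.
Proof.
move=> s0 d0; rewrite pdetE //; case: t => [|t]; last by rewrite det_mx00.
by rewrite det_mx11 !mxE big_ord1 !mxE mulr1.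
Qed.

Lemma pdet_neq0 n t : pdet n t != 0.
Proof.
elim: n t => [|n IH] t.
  apply/eqP => p0; have [s s0 Es] := exists_loop_root 1.
  have := @pdet0 s t s0; rewrite -Es oner_eq0 => /(_ isT)/eqP.
  by rewrite p0 horner0 eq_sym oner_eq0.
have E := pdet_rec n t; apply/eqP => p0; move: E; cbv zeta => /eqP.
rewrite p0 mul0r eq_sym !mulf_eq0 !expf_eq0 (negPf (chebU_neq0 K0 _)) // andbF.
rewrite (negPf (IH _)) /= orbF; case: (t) => [|t'] /=; rewrite ?oner_eq0 //.
by rewrite (negPf (IH _)).
Qed.

Lemma mupX (x : K) (p : {poly K}) d : p != 0 -> mup x (p ^+ d) = (d * mup x p)%N.
Proof.
move=> p0; elim: d => [|d IH]; first by rewrite expr0 mupNroot // root1.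
by rewrite exprS mupM ?expf_neq0 // IH mulSn.
Qed.

Variables (s0 : K) (ell : nat).
Let x0 := s0 ^+ 2 + s0 ^- 2.
Hypothesis s00 : s0 != 0.
Hypothesis x00 : x0 != 0.
Hypothesis cheb_ell : forall m, (0 < m)%N -> ((chebU K m).[x0] == 0) = (ell %| m)%N.

Definition pmult n t := mup x0 (pdet n t).
Definition pmult_pop n t := if t is t'.+1 then pmult n t' else 0%N.

Lemma pmult_rec n t : let d := nwords n t.+1 in
  (pmult n.+1 t + d * (ell %| t.+1) = pmult_pop n t + (d * (ell %| t.+2) + pmult n t.+1))%N.
Proof.
move=> d; have := congr1 (mup x0) (pdet_rec n t); rewrite -/d.
have pp0 : pdet_pop n t != 0.
  by case: (t) => [|t'] /=; rewrite ?oner_eq0 ?pdet_neq0.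
rewrite !mupM ?mulf_neq0 ?expf_neq0 ?pdet_neq0 ?chebU_neq0 //.
rewrite !mupX ?chebU_neq0 // !mup_chebU // !cheb_ell // => ->.
congr (_ + _)%N; case: (t) => [|t'] //=.
by rewrite mupNroot // root1.
Qed.

(* Additive form of the product formula for the Gram determinant,
   [det G_t(n) = prod_(j >= 1) ([t+1+j]/[j]) ^ dim W_(t+2j)(n)]. *)
Lemma pmult_closed N n t : (n <= N)%N ->
  (pmult n t + \sum_(j < N) nwords n (t + 2 * j.+1) * (ell %| j.+1) =
   \sum_(j < N) nwords n (t + 2 * j.+1) * (ell %| t.+1 + j.+1))%N.
Proof.
elim: n t => [|n IH] t nN.
  rewrite /pmult mupNroot; last by rewrite /root pdet0 // oner_eq0.
  rewrite add0n; apply: eq_bigr => j _; by rewrite nwords_gt //; lia.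
(* The [j]-th term for [n.+1] splits into [a j] from the pop and [a j.+1] from the push. Since
   [a N = 0], shifting the index loses nothing at the upper end. *)
pose a (j : nat) : nat := nwords n (t.+1 + 2 * j)%N.
have aN : a N = 0%N by apply: nwords_gt; lia.
have E (f : nat -> nat) : (\sum_(j < N) nwords n.+1 (t + 2 * j.+1) * f j =
    \sum_(j < N) a j * f j + \sum_(j < N) a j.+1 * f j)%N.
  rewrite -big_split /=; apply: eq_bigr => j _; rewrite -mulnDl; congr (_ * _)%N.
  have -> : (t + 2 * j.+1 = (t.+1 + 2 * j).+1)%N by lia.
  by rewrite /=; congr (_ + nwords _ _)%N; lia.
have shift (f : nat -> nat) : (\sum_(j < N) a j * f j = a 0 * f 0 + \sum_(j < N) a j.+1 * f j.+1)%N.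
  have := @big_ord_recl nat 0%N addn N (fun j : 'I_N.+1 => a j * f j)%N.
  by rewrite big_ord_recr /= aN mul0n addn0.
rewrite (E (fun j => ell %| j.+1)%N) (E (fun j => ell %| t.+1 + j.+1)%N).
have R := pmult_rec n t.
have R1 : (pmult n t.+1 + \sum_(j < N) a j.+1 * (ell %| j.+1) =
  \sum_(j < N) a j.+1 * (ell %| t.+2 + j.+1))%N := IH t.+1 (ltnW nN).
have R0 : (pmult_pop n t + \sum_(j < N) a j * (ell %| j.+1) =
  \sum_(j < N) a j * (ell %| t + j.+1))%N.
  case: (t) @a {R R1 E shift aN} => [|t'] a //=.
  have := IH t' (ltnW nN); congr (_ + _ = _)%N; apply: eq_bigr => j _;
    rewrite ?addSnnS; congr (nwords _ _ * _)%N; lia.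
have S0 := shift (fun j => nat_of_bool (ell %| t + j.+1)%N).
have S1 := shift (fun j => nat_of_bool (ell %| t.+1 + j.+1)%N).
have a0 : a 0%N = nwords n t.+1 by rewrite /a muln0 addn0.
have X1 : (\sum_(j < N) a j.+1 * (ell %| t + j.+2) =
           \sum_(j < N) a j.+1 * (ell %| t.+1 + j.+1))%N.
  by apply: eq_bigr => j _; rewrite addSnnS.
have X2 : (\sum_(j < N) a j.+1 * (ell %| t.+1 + j.+2) =
           \sum_(j < N) a j.+1 * (ell %| t.+2 + j.+1))%N.
  by apply: eq_bigr => j _; rewrite [in RHS]addSnnS.
rewrite /= !addn1 a0 in S0 S1; rewrite X1 in S0; rewrite X2 in S1.
cbv zeta in R; rewrite S0 in R0; rewrite S1 {X1 X2 S0 S1}.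
move: R R1 R0.
move: (nwords n t.+1 * (ell %| t.+1))%N (nwords n t.+1 * (ell %| t.+2))%N => A B.
move: (\sum_(j < N) a j * (ell %| j.+1))%N (\sum_(j < N) a j.+1 * (ell %| j.+1))%N => C D.
move: (\sum_(j < N) a j.+1 * (ell %| t.+1 + j.+1))%N => F.
move: (\sum_(j < N) a j.+1 * (ell %| t.+2 + j.+1))%N => G.
lia.
Qed.

(** When [ell] divides [t.+1], the two divisibility conditions in [pmult_closed] agree term by term
    and the sums cancel. *)
Lemma pmult_wall n t : (ell %| t.+1)%N -> pmult n t = 0%N.
Proof.
move=> lt; have := pmult_closed t (leqnn n).
under [in RHS]eq_bigr do rewrite dvdn_addr //.
by rewrite -[RHS]add0n => /addIn.
Qed.

Lemma gram_wall n t : (ell %| t.+1)%N -> \rank (gram s0 n t) = nwords n t.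
Proof.
move=> lt; apply/eqP; rewrite -[_ == _]/(row_free _) row_free_unit unitmxE unitfE.
rewrite -pdetE // -/x0 -[_ == 0]/(root _ _) -dvdp_XsubCl XsubC_dvd ?pdet_neq0 //.
by rewrite -/(pmult n t) pmult_wall.
Qed.

End WallDeterminant.

(** * Generating functions *)

Section Series.

Definition fps_X : fps rat := FPS (fun n => (n == 1%N)%:R).

Lemma coef_fpsD (f g : fps rat) k : (f + g) k = f k + g k. Proof. by []. Qed.

Lemma coef_fpsXM (f : fps rat) k : (fps_X * f) k = if k is k'.+1 then f k' else 0.
Proof.
rewrite /GRing.mul /=; case: k => [|k]; first by rewrite big_ord1 mul0r.
rewrite !big_ord_recl /= mul0r add0r mul1r subSS subn0 big1 ?addr0 // => i _.
by rewrite mul0r.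
Qed.

(** Multiplication by [fps_X] lowers the coefficient index, so induction on the index first and on
    [r] second is well founded. *)
Lemma fps_rec_unique (G H : nat -> fps rat) : G 0%N = H 0%N ->
  (forall r, G r.+1 = G r + fps_X * G r.+2) ->
  (forall r, H r.+1 = H r + fps_X * H r.+2) -> G =1 H.
Proof.
move=> GH0 GS HS r; apply: fps_ext => k; elim: k r => [|k IHk]; elim=> [|r IHr];
  by rewrite ?GH0 // GS HS !coef_fpsD !coef_fpsXM ?IHk IHr.
Qed.

(* For [r > 0] the generating series of the dimensions of the cell modules
   [W_(r-1)]. *)
Definition path_series r : fps rat :=
  if r is r'.+1 then FPS (fun k => (nwords (r' + 2 * k) r')%:R) else 1.

Lemma path_seriesS r : path_series r.+1 = path_series r + fps_X * path_series r.+2.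
Proof.
apply: fps_ext => k; rewrite coef_fpsD coef_fpsXM.
case: r => [|r]; rewrite /path_series /fps_coef; case: k => [|k].
- by rewrite addr0.
- rewrite add0r; congr (_%:R).
  by have -> : (0 + 2 * k.+1 = (1 + 2 * k).+1)%N by lia.
- by rewrite !muln0 !addn0 /= (@nwords_gt r r.+2) // addn0 addr0.
rewrite -natrD; congr (_%:R).
have -> : (r.+1 + 2 * k.+1 = (r + 2 * k.+1).+1)%N by lia.
by rewrite [LHS]/=; congr (_ + nwords _ _)%N; lia.
Qed.

(** The shifted sequence and [path_series 1] times the sequence satisfy the same recursion and agree
    at 0, so each step in [r] multiplies by [path_series 1]. *)
Lemma path_series_exp r : path_series r = path_series 1 ^+ r.
Proof.
elim: r => // r IH; rewrite exprS -IH.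
have := @fps_rec_unique (fun r => path_series r.+1) (fun r => path_series 1 * path_series r).
apply => [|r'|r']; first by rewrite mulr1.
  exact: path_seriesS.
by rewrite (path_seriesS r') mulrDr; congr (_ + _); rewrite mulrCA.
Qed.

(** The ballot numbers [C(n, k) - C(n, k-1)], written additively to avoid truncated subtraction. *)
Lemma nwords_ballot n t k : n = (t + 2 * k)%N ->
  (nwords n t + (if k is k'.+1 then 'C(n, k') else 0) = 'C(n, k))%N.
Proof.
elim: n t k => [|n IH] t k nE.
  by have [-> ->] : t = 0%N /\ k = 0%N by lia.
case: t nE => [|t] nE /=.
  case: k nE => [|k] nE; first lia.
  have H := IH 1%N k; rewrite binS.
  have -> : 'C(n, k.+1) = 'C(n, k).
    have kn : (k.+1 <= n)%N by lia.
    by rewrite -(bin_sub kn); congr 'C(n, _); lia.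
  by case: k nE H => [|k] nE H; rewrite ?binS ?bin0 in H *; lia.
case: k nE => [|k] nE.
  rewrite bin0 (@nwords_gt n t.+2); last lia.
  by have := IH t 0%N; rewrite bin0; lia.
rewrite binS; have H1 := IH t k.+1; have H2 := IH t.+2 k.
by case: k nE H1 H2 => [|k] nE H1 H2; rewrite ?binS ?bin0 in H1 H2 *; lia.
Qed.

Lemma path_series1 : path_series 1 = catalan.
Proof.
apply: fps_ext => k /=; rewrite add0n.
have := @nwords_ballot (2 * k) 0 k erefl => B.
apply: (mulfI (_ : k.+1%:R != 0)); first by rewrite pnatr_eq0.
rewrite mulrA divff ?pnatr_eq0 // mul1r -natrM; congr (_%:R).
case: k B => [|k] B; first by rewrite -B mul1n addn0.
have := mul_bin_left (2 * k.+1) k.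
have -> : (2 * k.+1 - k = k.+2)%N by lia.
nia.
Qed.

Lemma catalan_exp r : catalan ^+ r = path_series r.
Proof. by rewrite path_series_exp path_series1. Qed.

Lemma jones_polySS i : jones_poly i.+2 = jones_poly i.+1 - 'X * jones_poly i.
Proof. by case: i => //=; rewrite mulr0 subr0. Qed.

Lemma jones_poly_coef0 i : (jones_poly i.+1)`_0 = 1.
Proof.
elim: i => [|i IH]; first by rewrite coef1.
by rewrite jones_polySS coefB IH coefXM subr0.
Qed.

Lemma fps_jones i : fps_of_poly (jones_poly i.+1) =
  fps_of_poly (jones_poly i.+2) + fps_X * fps_of_poly (jones_poly i).
Proof.
apply: fps_ext => k; rewrite coef_fpsD coef_fpsXM jones_polySS /= coefB coefXM.
by case: k => [|k] /=; rewrite ?subr0 ?addr0 // rmorphB /= subrK.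
Qed.

Variables (ell : nat) (r : nat -> nat -> nat).
Hypothesis ell3 : (2 < ell)%N.
Hypothesis r_le : forall n t, (r n t <= nwords n t)%N.
Hypothesis r0 : r 0 0 = 1%N.
Let rpop n t := if t is t'.+1 then r n t' else 0%N.
Hypothesis r_wall : forall n t, (ell %| t.+1)%N -> r n t = nwords n t.
Hypothesis r_step : forall n t, ~~ (ell %| t.+1)%N -> ~~ (ell %| t.+2)%N ->
  r n.+1 t = (rpop n t + r n t.+1)%N.
Hypothesis r_last : forall n t, ~~ (ell %| t.+1)%N -> (ell %| t.+2)%N ->
  r n.+1 t = rpop n t.

(* At [b = ell - 1] the numerator is the dummy value [jones_poly 0 = 0], as the
   recursion below requires. *)
Definition fusion_series a b : fps rat :=
  fps_of_poly (jones_poly (ell.-1 - b)) / fps_of_poly (jones_poly ell)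
    * catalan ^+ (a * ell).

Lemma fps_jones_unit i : fps_of_poly (jones_poly i.+1) \is a GRing.unit.
Proof. by rewrite unfold_in /= /fps_unit /= jones_poly_coef0 unitr1. Qed.

(** The recursion of [jones_poly] divided by [jones_poly ell]. One step left of [b = 0] the
    numerator is [jones_poly ell] itself, which leaves the pure Catalan power. *)
Lemma fusion_series_rec a b : (b < ell.-1)%N ->
  fusion_series a b = (if b is b'.+1 then fusion_series a b' else catalan ^+ (a * ell))
    + fps_X * fusion_series a b.+1.
Proof.
move=> bl; have [i iE] : exists i, (ell.-1 - b = i.+1)%N by exists (ell.-1 - b).-1; lia.
have E : (if b is b'.+1 then fusion_series a b' else catalan ^+ (a * ell)) =
    fps_of_poly (jones_poly i.+2) / fps_of_poly (jones_poly ell) * catalan ^+ (a * ell).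
  case: b bl iE => [|b] bl iE.
    have <- : ell = i.+2 by lia.
    by rewrite divrr ?mul1r // -(prednK (ltnW (ltnW ell3))) fps_jones_unit.
  by rewrite /fusion_series; congr (fps_of_poly (jones_poly _) / _ * _); lia.
rewrite E /fusion_series iE fps_jones.
have -> : (ell.-1 - b.+1 = i)%N by lia.
by rewrite !mulrDl !mulrA.
Qed.

Lemma fusion_seriesE n a b k : n = (a * ell + b + 2 * k)%N -> (b < ell.-1)%N ->
  (r n (a * ell + b))%:R = fusion_series a b k.
Proof.
elim: n a b k => [|n IH] a b k nE bl.
  have [a0 [b0 k0]] : a = 0%N /\ b = 0%N /\ k = 0%N by nia.
  by subst a b k; rewrite fusion_series_rec // coef_fpsD coef_fpsXM addr0 r0.
have nd1 : ~~ (ell %| (a * ell + b).+1)%N.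
  by rewrite -addnS dvdn_addr ?dvdn_mull // gtnNdvd //; lia.
have popE : (rpop n (a * ell + b))%:R =
    (if b is b'.+1 then fusion_series a b' else catalan ^+ (a * ell)) k.
  case: b nE bl {nd1} => [|b] nE bl; last first.
    by rewrite addnS /= (IH a b k) //; lia.
  rewrite addn0 in nE *; rewrite catalan_exp.
  (* For [a = 0] there is no left wall and the pop term is 0. The series is then 1, and
     [n.+1 = 2 * k] excludes its only nonzero coefficient. For [a > 0] the pop term sits on the wall
     [a * ell - 1]. *)
  case: a nE => [|a] nE; first by case: k nE.
  have aE : (a.+1 * ell = (a.+1 * ell).-1.+1)%N by lia.
  rewrite aE /= r_wall -?aE ?dvdn_mull //; congr (nwords _ _)%:R; lia.
have nextE : (b.+1 < ell.-1)%N -> (r n (a * ell + b).+1)%:R =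
    (if k is k'.+1 then fusion_series a b.+1 k' else 0).
  move=> bl'; case: k nE {popE} => [|k] nE; last by rewrite -addnS (IH a b.+1 k) //; lia.
  by have := r_le n (a * ell + b).+1; rewrite nwords_gt ?leqn0 => [/eqP-> //|]; lia.
rewrite fusion_series_rec // coef_fpsD coef_fpsXM -popE.
have [bl'|bl'] := boolP (b.+1 < ell.-1)%N.
  rewrite r_step // ?natrD ?nextE //.
  by rewrite -!addnS dvdn_addr ?dvdn_mull // gtnNdvd //; lia.
rewrite r_last //; last first.
  by rewrite -!addnS dvdn_addr ?dvdn_mull //; have -> : b.+2 = ell by lia.
rewrite /fusion_series; have -> : (ell.-1 - b.+1 = 0)%N by lia.
have -> : fps_of_poly (jones_poly 0) = 0 by apply: fps_ext => j /=; rewrite coef0.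
by rewrite !mul0r; case: (k) => [|k'] /=; rewrite addr0.
Qed.

End Series.

(** * Dimensions of the simple quotients *)

Section FfunRank.
Variables (K : fieldType) (I : finType) (d : nat) (e : 'I_d -> I) (e' : I -> 'I_d).
Hypotheses (eK : cancel e e') (e'K : cancel e' e).
Variable G : 'M[K]_d.
Local Notation V := {ffun I -> K^o}.

Definition ffun_coord (u : V) : 'rV[K]_(\rank G) := (\row_i (u (e i) : K)) *m col_base G.

Lemma ffun_coord_linear : linear ffun_coord.
Proof.
move=> k u v; rewrite /ffun_coord scalemxAl -mulmxDl; congr (_ *m _).
by apply/rowP => i; rewrite !mxE !ffunE.
Qed.
HB.instance Definition _ :=
  GRing.isLinear.Build K V 'rV[K]_(\rank G) _ ffun_coord ffun_coord_linear.

Definition ffun_of_coord (w : 'rV[K]_(\rank G)) : V :=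
  [ffun j => (w *m row_base G) 0 (e' j) : K^o].

Lemma ffun_of_coord_linear : linear ffun_of_coord.
Proof.
by move=> k u v; apply/ffunP => j; rewrite !ffunE mulmxDl -scalemxAl !mxE.
Qed.
HB.instance Definition _ :=
  GRing.isLinear.Build K 'rV[K]_(\rank G) V _ ffun_of_coord ffun_of_coord_linear.

(** The rank factorisation [col_base G *m row_base G] writes [f] as a surjection onto a space of
    dimension [\rank G] followed by an injection. *)
Lemma dim_limg_ffun (f : 'End(V)) :
  (forall u j, f u j = \sum_i u i * G (e' i) (e' j)) -> \dim (limg f) = \rank G.
Proof.
move=> fE.
have -> : f = (linfun ffun_of_coord \o linfun ffun_coord)%VF.
  apply/lfunP => u; rewrite lfunE /= !lfunE; apply/ffunP => j.
  rewrite /= ffunE /ffun_coord -mulmxA mulmx_base mxE fE.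
  rewrite (reindex e) /=; last by exists e' => i _; rewrite ?eK ?e'K.
  by apply: eq_bigr => i _; rewrite mxE eK.
rewrite limg_comp.
have -> : limg (linfun ffun_coord) = fullv.
  apply/eqP; rewrite eqEsubv subvf; apply/subvP => w _; apply/memv_imgP.
  have /row_fullP[B BG] := col_base_full G.
  exists [ffun j => (w *m B) 0 (e' j) : K^o]; first exact: memvf.
  rewrite lfunE /= /ffun_coord.
  have -> : (\row_i ([ffun j => (w *m B) 0 (e' j) : K^o] (e i) : K)) = w *m B.
    by apply/rowP => i; rewrite mxE ffunE eK.
  by rewrite -mulmxA BG mulmx1.
rewrite limg_dim_eq; first by rewrite dimvf /dim /= mul1n.
apply/eqP; rewrite capfv; apply/lker0P => u v; rewrite !lfunE /= => /ffunP E.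
have /row_freeP[B GB] := row_base_free G.
rewrite -[u]mulmx1 -[v]mulmx1 -GB [LHS]mulmxA [RHS]mulmxA; congr (_ *m B).
by apply/rowP => i; have := E (e i); rewrite !ffunE eK.
Qed.

End FfunRank.

Section Enumeration.
Variables n t : nat.

Lemma diagram_of_index_exists (i : 'I_(nwords n t)) :
  exists D : monic_diagram t n, word_of (val D) == nth [::] (words n t) i.
Proof.
have : nth [::] (words n t) i \in words n t by rewrite mem_nth // size_words.
by move=> /(@word_of_surj t n)[D mD E]; exists (Sub D mD); rewrite SubK E.
Qed.

Definition diagram_of_index i : monic_diagram t n := xchoose (diagram_of_index_exists i).

Lemma word_of_index i : word_of (val (diagram_of_index i)) = nth [::] (words n t) i.
Proof. exact/eqP/(xchooseP (diagram_of_index_exists i)). Qed.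

Lemma index_of_diagram_lt (D : monic_diagram t n) :
  (index (word_of (val D)) (words n t) < nwords n t)%N.
Proof. by rewrite -size_words index_mem word_of_words ?(valP D). Qed.

Definition index_of_diagram D : 'I_(nwords n t) := Ordinal (index_of_diagram_lt D).

Lemma diagram_of_indexK : cancel diagram_of_index index_of_diagram.
Proof.
by move=> i; apply: val_inj; rewrite /= word_of_index index_uniq ?size_words ?words_uniq.
Qed.

Lemma index_of_diagramK : cancel index_of_diagram diagram_of_index.
Proof.
move=> D; apply/val_inj/word_of_inj; rewrite ?(valP (diagram_of_index _)) ?(valP D) //.
by rewrite word_of_index nth_index // word_of_words ?(valP D).
Qed.

End Enumeration.

Section GramMatrix.
Variables n t : nat.

(** The Gram matrix with an indeterminate loop value, as needed by the multiplicity argument on the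
    walls. *)
Definition gram_poly (K : fieldType) : 'M[{poly K}]_(nwords n t) :=
  \matrix_(i, j)
    let D1 := tl_reflect (val (diagram_of_index i)) in
    let D2 := val (diagram_of_index j) in
    if stacks_to D1 D2 (tl_id t) then 'X ^+ stack_loops D1 D2 else 0.

Lemma stack_coef_gram (K : fieldType) (s : K) i j : s != 0 -> s ^+ 2 + s ^- 2 != 0 ->
  stack_coef (tl_reflect (val (diagram_of_index i))) (val (diagram_of_index j))
    (s ^+ 2 + s ^- 2) (tl_id t) = gram s n t i j.
Proof.
move=> s0 d0; have mi := valP (diagram_of_index i); have mj := valP (diagram_of_index j).
rewrite stack_coefE // gramE.
under eq_bigr do rewrite !diagram_weightE // !word_of_index.
exact: (@sum_color_word K t n (fun w => autw s _ w (nseq t true) * autw s _ w (nseq t true))).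
Qed.

Lemma gram_polyE (K : fieldType) (s : K) : s != 0 -> s ^+ 2 + s ^- 2 != 0 ->
  map_mx (horner_eval (s ^+ 2 + s ^- 2)) (gram_poly K) = gram s n t.
Proof.
move=> s0 d0; apply/matrixP => i j; rewrite -stack_coef_gram // !mxE /stack_coef /horner_eval /=.
by case: ifP => _; rewrite ?hornerXn ?horner0.
Qed.

Lemma dim_simple_quotient (K : fieldType) (q s : K) : s != 0 -> s ^+ 2 + s ^- 2 != 0 ->
  loop_value q = s ^+ 2 + s ^- 2 ->
  \dim {: simple_quotient q t n} = \rank (gram s n t).
Proof.
move=> s0 d0 qs.
rewrite (dim_quotv (cell_rad q t n)).
have := limg_ker_dim (linfun (@cell_form_ffun K q t n)) fullv.
rewrite capfv -/(cell_rad q t n) => <-; rewrite addKn.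
apply: (dim_limg_ffun (@diagram_of_indexK n t) (@index_of_diagramK n t)) => u j.
rewrite lfunE /= ffunE; apply: eq_bigr => i _; congr (_ * _).
by rewrite /cell_gram qs -(stack_coef_gram _ _ s0 d0) !index_of_diagramK.
Qed.

End GramMatrix.

Local Open Scope complex_scope.

Theorem theorem6p6 (R : realType) (q : R[i]) (ell t a b : nat)
    (hq : q != 0) (hord : ell.-primitive_root (q ^+ 2)) (hell : (4 <= ell)%N)
    (hb : (b <= ell - 2)%N) (ht : t = (a * ell + b)%N) :
  simple_series q t =
    fps_of_poly (jones_poly (ell - 1 - b)) / fps_of_poly (jones_poly ell)
      * catalan ^+ (a * ell).
Proof.
pose s := sqrtC (- q).
have s2 : s ^+ 2 = - q by exact: sqrtCK.
have s0 : s != 0.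
  apply/eqP => s00; move: s2 => /eqP.
  by rewrite s00 expr0n eq_sym oppr_eq0 (negPf hq).
have qs : loop_value q = s ^+ 2 + s ^- 2 by rewrite s2 invrN -opprD.
have q2 m : (0 < m < ell)%N -> q ^+ 2 ^+ m != 1.
  move=> /andP[m0 ml]; rewrite -(prim_order_dvd hord); apply/negP => /dvdn_leq; lia.
(* A vanishing loop value means [q ^ 2 = -1], so that [q ^ 2] would have order at most 2. *)
have d0 : s ^+ 2 + s ^- 2 != 0.
  rewrite -qs oppr_eq0; apply/eqP => /(congr1 ( *%R q)); rewrite mulr0 mulrDr divff // -expr2.
  move/eqP; rewrite addr_eq0 => /eqP e.
  by have := q2 2; rewrite e sqrrN expr1n eqxx => /(_ _)/negP; case=> //; lia.
(* Here [rho = q], so [qint s m] is the geometric sum of the powers of [q ^ 2], and [q ^ 2 != 1]. *)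
have qintE m : (qint s m == 0) = (ell %| m)%N.
  rewrite (prim_order_dvd hord) -[RHS]subr_eq0 subrX1 mulf_eq0 subr_eq0.
  have := q2 1%N; rewrite expr1 => /(_ _)/negPf-> /=; last lia.
  rewrite /qint; congr (_ == 0); apply: eq_bigr => i _.
  by rewrite /rho s2 opprK exprM.
have cheb m : (0 < m)%N -> ((chebU _ m).[s ^+ 2 + s ^- 2] == 0) = (ell %| m)%N.
  by move=> _; rewrite chebU_root_qint.
have wall n t' : (ell %| t'.+1)%N -> \rank (gram s n t') = nwords n t'.
  exact: (@gram_wall _ (fun n t => gram_poly n t _)
    (fun s n t => @gram_polyE n t _ s) s ell s0 d0 cheb).
have rank_rec := @fusion_seriesE ell (fun n t => \rank (gram s n t)).
apply: fps_ext => k; rewrite /simple_series /= (dim_simple_quotient _ _ s0 d0 qs) ht.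
rewrite (rank_rec _ _ _ _ _ _ _ a b k) //; last by lia.
- by rewrite /fusion_series; congr ((fps_of_poly (jones_poly _) / _ * _) k); lia.
- by lia.
- by move=> n t'; rewrite rank_leq_row.
- suff -> : gram s 0 0 = 1%:M by rewrite mxrank1.
  by apply/matrixP => i j; rewrite !ord1 !mxE big_ord1 !mxE mulr1.
- move=> n t' h1 h2; rewrite rank_gram_step ?qintE //.
  by congr (_ + _)%N; case: t' {h1 h2} => //=; rewrite [gram_pop _ _ _]flatmx0 mxrank0.
move=> n t' h1 h2; rewrite rank_gram_wall ?qintE //; last by apply/eqP; rewrite qintE.
by case: t' {h1 h2} => //=; rewrite [gram_pop _ _ _]flatmx0 mxrank0.
Qed.
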